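(* Let $k$ be a field. For $n\ge1$ and $i\in[n]$ let $K_i\subseteq M(n)$ be the kernel of the homomorphism $f_i:M(n)=k\mathscr Ce_n\to k\mathscr C\alpha_{n-1,i}$, $e_n\mapsto\alpha_{n-1,i}$. Then for every $n\in\mathbb N$ the submodule $\bigcap_{i\in[n]}K_i$ of $M(n)$ (interpreted as $M(0)$ when $n=0$) is a simple saturated $\mathscr C$-module. Furthermore, every simple saturated $\mathscr C$-module is of this form up to isomorphism.
   Context: $\mathscr C$ is the category with objects $[n]=\{1,\dots,n\}$, $n\in\mathbb N=\{0,1,\dots\}$, $[0]=\emptyset$, and strictly increasing maps as morphisms. A $\mathscr C$-module is a functor $V:\mathscr C\to k\text{-Mod}$, $V_n=V([n])$; $\mathscr C\text{-Mod}$ is the category of these. $k\mathscr C$ is the category algebra (basis: all morphisms; product: composition when defined, $0$ otherwise), $e_n=\mathrm{id}_{[n]}$, and $M(n)=k\mathscr C([n],-)=k\mathscr Ce_n$. For $m\ge0$ and $i\in[m+1]$, $\alpha_{m,i}:[m]\to[m+1]$ is the morphism whose image does not contain $i$. Thus $k\mathscr C\alpha_{n-1,i}$ is the submodule of $M(n-1)$ generated by $\alpha_{n-1,i}$, and $f_i(\beta)=\beta\circ\alpha_{n-1,i}$. An element $v\in V_n$ is torsion if $\alpha\cdot v=0$ for some morphism $\alpha:[n]\to[n+s]$; $V$ is torsion if all its elements $v\in V_n$, $n\in\mathbb N$, are torsion. $V$ is saturated if $\mathrm{Hom}(T,V)=0=\mathrm{Ext}^1(T,V)$ for every torsion $\mathscr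 C$-module $T$; equivalently $(\mathrm{sec}\circ\mathrm{loc})V\cong V$, where $\mathrm{loc}:\mathscr C\text{-Mod}\to\mathscr C\text{-Mod}/\mathscr C\text{-Mod}^{\mathrm{tor}}$ is the localization functor to the Serre quotient by the torsion modules and $\mathrm{sec}$ is its right adjoint (section functor). The full subcategory $\mathscr C\text{-Mod}^{\mathrm{sa}}$ of saturated modules is equivalent, via $\mathrm{loc}$ and $\mathrm{sec}$, to the Serre quotient and carries the corresponding abelian structure: kernels are as in $\mathscr C\text{-Mod}$, and the cokernel of $\alpha:V\to W$ is $(\mathrm{sec}\circ\mathrm{loc})(W/\alpha(V))$. A simple saturated module is a simple object of the abelian category $\mathscr C\text{-Mod}^{\mathrm{sa}}$ (not necessarily simple in $\mathscr C\text{-Mod}$). *)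

(* Defs.v *)
From HB Require Import structures.
From mathcomp Require Import all_boot all_order all_algebra.
From mathcomp Require Import boolp.

Set Implicit Arguments.
Unset Strict Implicit.
Unset Printing Implicit Defensive.
Import GRing.Theory.
Local Open Scope ring_scope.

(* The object [n] = {1, ..., n} is represented by 'I_n = {0, ..., n - 1}. *)
Definition increasing m n (a : {ffun 'I_m -> 'I_n}) : bool :=
  [forall i : 'I_m, forall j : 'I_m, (i < j)%N ==> (a i < a j)%N].

Record mor (m n : nat) := Mor {
  mor_fun :> {ffun 'I_m -> 'I_n};
  morP : increasing mor_fun
}.

HB.instance Definition _ m n := [isSub for @mor_fun m n].
HB.instance Definition _ m n := [Finite of mor m n by <:].

Lemma mor_lt m n (a : mor m n) (i j : 'I_m) : (i < j)%N -> (a i < a j)%N.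
Proof. by move: (morP a) => /forallP/(_ i)/forallP/(_ j)/implyP. Qed.

Fact mor_id_subproof n : increasing [ffun i : 'I_n => i].
Proof. by apply/forallP=> i; apply/forallP=> j; rewrite !ffunE; apply/implyP. Qed.
Definition mor_id n : mor n n := Mor (mor_id_subproof n).

Fact mor_comp_subproof l m n (b : mor m n) (a : mor l m) :
  increasing [ffun i => b (a i)].
Proof.
apply/forallP=> i; apply/forallP=> j; rewrite !ffunE; apply/implyP=> ij.
by do 2!apply: mor_lt.
Qed.
Definition mor_comp l m n (b : mor m n) (a : mor l m) : mor l n :=
  Mor (mor_comp_subproof b a).

Lemma mor_compE l m n (b : mor m n) (a : mor l m) i :
  mor_comp b a i = b (a i).
Proof. by rewrite /= ffunE. Qed.

Lemma mor_eqP m n (a b : mor m n) : a =1 b -> a = b.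
Proof. by move=> ab; apply/val_inj/ffunP. Qed.

Lemma mor_compA l m n p (c : mor n p) (b : mor m n) (a : mor l m) :
  mor_comp c (mor_comp b a) = mor_comp (mor_comp c b) a.
Proof. by apply: mor_eqP => i; rewrite !mor_compE. Qed.

Lemma mor_comp1m m n (a : mor m n) : mor_comp (mor_id n) a = a.
Proof. by apply: mor_eqP => i; rewrite mor_compE /= ffunE. Qed.

Lemma mor_compm1 m n (a : mor m n) : mor_comp a (mor_id m) = a.
Proof. by apply: mor_eqP => i; rewrite mor_compE /= ffunE. Qed.

Fact skip_subproof m (i : 'I_m.+1) : increasing [ffun j => lift i j].
Proof.
apply/forallP=> j; apply/forallP=> l; rewrite !ffunE; apply/implyP=> jl.
by rewrite /= /bump -addnS leq_add //; case: (leqP i j) => // /leq_trans-> //;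
  exact: ltnW.
Qed.
(* alpha_{m,i} : [m] -> [m+1], the morphism whose image omits i *)
Definition skip m (i : 'I_m.+1) : mor m m.+1 := Mor (skip_subproof i).

Record cmodule (k : fieldType) := CModule {
  cm_obj :> nat -> lmodType k;
  cm_act : forall m n : nat, mor m n -> {linear cm_obj m -> cm_obj n};
  cm_act1 : forall n x, cm_act (mor_id n) x = x;
  cm_actM : forall l m n (b : mor m n) (a : mor l m) x,
    cm_act (mor_comp b a) x = cm_act b (cm_act a x)
}.
Arguments cm_act {k} c {m n} a.

Record cm_hom (k : fieldType) (V W : cmodule k) := CMHom {
  hom_fun :> forall n, {linear V n -> W n};
  hom_nat : forall m n (a : mor m n) (x : V m),
    hom_fun n (cm_act V a x) = cm_act W a (hom_fun m x)
}.
Arguments hom_fun {k V W} c n.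

Definition cm_iso (k : fieldType) (V W : cmodule k) (f : cm_hom V W) : Prop :=
  exists g : cm_hom W V,
    (forall n x, g n (f n x) = x) /\ (forall n y, f n (g n y) = y).

Definition isomorphic (k : fieldType) (V W : cmodule k) : Prop :=
  exists f : cm_hom V W, cm_iso f.

Definition zero_cmodule (k : fieldType) (V : cmodule k) : Prop :=
  forall n (x : V n), x = 0.

Definition dsum_act_fun (k : fieldType) (V W : cmodule k) m n (a : mor m n)
    (x : V m * W m) : V n * W n := (cm_act V a x.1, cm_act W a x.2).
Fact dsum_act_linear (k : fieldType) (V W : cmodule k) m n (a : mor m n) :
  linear (@dsum_act_fun k V W m n a).
Proof. by move=> c x y; rewrite /dsum_act_fun /= !linearP. Qed.
HB.instance Definition _ (k : fieldType) (V W : cmodule k) m n (a : mor m n) :=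
  GRing.isLinear.Build k (V m * W m)%type (V n * W n)%type *:%R
    (@dsum_act_fun k V W m n a) (@dsum_act_linear k V W m n a).

Definition dsum_act (k : fieldType) (V W : cmodule k) m n (a : mor m n) :
    {linear (V m * W m)%type -> (V n * W n)%type} :=
  @dsum_act_fun k V W m n a.

Fact dsum_act1 (k : fieldType) (V W : cmodule k) n x :
  dsum_act V W (mor_id n) x = x.
Proof. by case: x => x y; rewrite /= /dsum_act_fun !cm_act1. Qed.

Fact dsum_actM (k : fieldType) (V W : cmodule k) l m n
    (b : mor m n) (a : mor l m) x :
  dsum_act V W (mor_comp b a) x = dsum_act V W b (dsum_act V W a x).
Proof. by rewrite /= /dsum_act_fun !cm_actM. Qed.

Definition dsum (k : fieldType) (V W : cmodule k) : cmodule k :=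
  CModule (@dsum_act1 k V W) (@dsum_actM k V W).

Definition dsum_in1_fun (k : fieldType) (V W : cmodule k) n (x : V n) :
  dsum V W n := (x, 0).
Fact dsum_in1_linear (k : fieldType) (V W : cmodule k) n :
  linear (@dsum_in1_fun k V W n).
Proof.
by move=> c x y; apply/pair_equal_spec; split; rewrite //= scaler0 addr0.
Qed.
HB.instance Definition _ (k : fieldType) (V W : cmodule k) n :=
  GRing.isLinear.Build k (V n) (dsum V W n) *:%R (@dsum_in1_fun k V W n)
    (@dsum_in1_linear k V W n).
Fact dsum_in1_nat (k : fieldType) (V W : cmodule k) m n (a : mor m n) x :
  @dsum_in1_fun k V W n (cm_act V a x) =
  cm_act (dsum V W) a (dsum_in1_fun W x).
Proof. by apply/pair_equal_spec; split; rewrite //= linear0. Qed.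
Definition dsum_in1 (k : fieldType) (V W : cmodule k) : cm_hom V (dsum V W) :=
  @CMHom k V (dsum V W) (fun n => @dsum_in1_fun k V W n)
    (@dsum_in1_nat k V W).

Definition dsum_pr2_fun (k : fieldType) (V W : cmodule k) n (x : dsum V W n) :
  W n := x.2.
Fact dsum_pr2_linear (k : fieldType) (V W : cmodule k) n :
  linear (@dsum_pr2_fun k V W n).
Proof. by []. Qed.
HB.instance Definition _ (k : fieldType) (V W : cmodule k) n :=
  GRing.isLinear.Build k (dsum V W n) (W n) *:%R (@dsum_pr2_fun k V W n)
    (@dsum_pr2_linear k V W n).
Fact dsum_pr2_nat (k : fieldType) (V W : cmodule k) m n (a : mor m n)
    (x : dsum V W m) :
  dsum_pr2_fun (cm_act (dsum V W) a x) = cm_act W a (dsum_pr2_fun x).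
Proof. by []. Qed.
Definition dsum_pr2 (k : fieldType) (V W : cmodule k) : cm_hom (dsum V W) W :=
  @CMHom k (dsum V W) W (fun n => @dsum_pr2_fun k V W n)
    (@dsum_pr2_nat k V W).

Record extension (k : fieldType) (T V : cmodule k) := Extension {
  ext_mid : cmodule k;
  ext_in : cm_hom V ext_mid;
  ext_pr : cm_hom ext_mid T;
  ext_in_inj : forall n, injective (ext_in n);
  ext_pr_surj : forall n y, exists x, ext_pr n x = y;
  ext_exact : forall n x, ext_pr n x = 0 <-> exists v, ext_in n v = x
}.

(* Yoneda equivalence; such a phi is automatically an isomorphism. *)
Definition ext_equiv (k : fieldType) (T V : cmodule k)
    (E F : extension T V) : Prop :=
  exists phi : cm_hom (ext_mid E) (ext_mid F),
    (forall n v, phi n (ext_in E n v) = ext_in F n v) /\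
    (forall n x, ext_pr F n (phi n x) = ext_pr E n x).

Fact dsum_in1_inj (k : fieldType) (T V : cmodule k) n :
  injective (dsum_in1 V T n).
Proof. by move=> x y []. Qed.
Fact dsum_pr2_surj (k : fieldType) (T V : cmodule k) n (y : T n) :
  exists x, dsum_pr2 V T n x = y.
Proof. by exists (0, y). Qed.
Fact dsum_exact (k : fieldType) (T V : cmodule k) n (x : dsum V T n) :
  dsum_pr2 V T n x = 0 <-> exists v, dsum_in1 V T n v = x.
Proof.
split; last by case=> v <-.
by case: x => v t /= e; exists v; congr (_, _); exact/esym.
Qed.

Definition split_extension (k : fieldType) (T V : cmodule k) : extension T V :=
  Extension (@dsum_in1_inj k T V) (@dsum_pr2_surj k T V) (@dsum_exact k T V).

Definition hom_vanishes (k : fieldType) (T V : cmodule k) : Prop :=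
  forall f : cm_hom T V, forall n x, f n x = 0.

(* The zero of Ext^1(T, V) is the class of the split extension. *)
Definition ext1_vanishes (k : fieldType) (T V : cmodule k) : Prop :=
  forall E : extension T V, ext_equiv E (split_extension T V).

Definition torsion_elt (k : fieldType) (V : cmodule k) n (v : V n) : Prop :=
  exists s, exists a : mor n (n + s), cm_act V a v = 0.

Definition torsion (k : fieldType) (V : cmodule k) : Prop :=
  forall n (v : V n), torsion_elt v.

Definition saturated (k : fieldType) (V : cmodule k) : Prop :=
  forall T : cmodule k, torsion T -> hom_vanishes T V /\ ext1_vanishes T V.

(* Tested only against saturated W: the ambient category is the full
   subcategory of saturated modules, whose zero objects and isomorphisms are
   those of C-modules. *)
Definition sat_mono (k : fieldType) (U V : cmodule k) (f : cm_hom U V) : Prop :=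
  forall W : cmodule k, saturated W -> forall g h : cm_hom W U,
    (forall n x, f n (g n x) = f n (h n x)) -> forall n x, g n x = h n x.

Definition simple_saturated (k : fieldType) (V : cmodule k) : Prop :=
  [/\ saturated V,
      ~ zero_cmodule V
    & forall (U : cmodule k) (f : cm_hom U V), saturated U -> sat_mono f ->
        zero_cmodule U \/ cm_iso f].

Record submodule (k : fieldType) (V : cmodule k) := Submodule {
  sub_mem : forall n, {pred V n};
  sub_closed : forall n, GRing.submod_closed (@sub_mem n);
  sub_act : forall m n (a : mor m n) x,
    x \in @sub_mem m -> cm_act V a x \in @sub_mem n
}.
Arguments sub_mem {k V} s n : simpl never.

HB.instance Definition _ (k : fieldType) (V : cmodule k) (S : submodule V) n :=
  GRing.isSubmodClosed.Build k (V n) (sub_mem S n) (sub_closed S n).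

Record sub_carrier (k : fieldType) (V : cmodule k) (S : submodule V) n :=
  SubCarrier {
    sub_val :> V n;
    sub_valP : sub_val \in sub_mem S n
  }.

HB.instance Definition _ (k : fieldType) (V : cmodule k) (S : submodule V) n :=
  [isSub for @sub_val k V S n].
HB.instance Definition _ (k : fieldType) (V : cmodule k) (S : submodule V) n :=
  [Choice of sub_carrier S n by <:].
HB.instance Definition _ (k : fieldType) (V : cmodule k) (S : submodule V) n :=
  [SubChoice_isSubLmodule of sub_carrier S n by <:].

Definition sub_act_fun (k : fieldType) (V : cmodule k) (S : submodule V) m n
    (a : mor m n) (x : sub_carrier S m) : sub_carrier S n :=
  SubCarrier (sub_act a (sub_valP x)).
Fact sub_act_linear (k : fieldType) (V : cmodule k) (S : submodule V) m n
    (a : mor m n) : linear (@sub_act_fun k V S m n a).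
Proof. by move=> c x y; apply: val_inj; rewrite /= linearP. Qed.
HB.instance Definition _ (k : fieldType) (V : cmodule k) (S : submodule V) m n
    (a : mor m n) :=
  GRing.isLinear.Build k (sub_carrier S m) (sub_carrier S n) *:%R
    (@sub_act_fun k V S m n a) (sub_act_linear a).

Fact sub_act1 (k : fieldType) (V : cmodule k) (S : submodule V) n
    (x : sub_carrier S n) : sub_act_fun (mor_id n) x = x.
Proof. by apply: val_inj; rewrite /= cm_act1. Qed.
Fact sub_actM (k : fieldType) (V : cmodule k) (S : submodule V) l m n
    (b : mor m n) (a : mor l m) (x : sub_carrier S l) :
  sub_act_fun (mor_comp b a) x = sub_act_fun b (sub_act_fun a x).
Proof. by apply: val_inj; rewrite /= cm_actM. Qed.

Definition sub_cmodule (k : fieldType) (V : cmodule k) (S : submodule V) :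
    cmodule k :=
  @CModule k (fun n => sub_carrier S n)
    (fun m n a => @sub_act_fun k V S m n a) (@sub_act1 k V S) (@sub_actM k V S).

Fact full_closed (k : fieldType) (V : cmodule k) n :
  GRing.submod_closed (predT : {pred V n}).
Proof. by []. Qed.
Definition full_submodule (k : fieldType) (V : cmodule k) : submodule V :=
  @Submodule k V (fun n => predT) (@full_closed k V) (fun _ _ _ _ _ => isT).

Definition cap_mem (k : fieldType) (V : cmodule k) (I : finType)
    (S : I -> submodule V) n : {pred V n} :=
  [pred x | [forall i, x \in sub_mem (S i) n]].
Arguments cap_mem {k V I} S n : simpl never.
Fact cap_closed (k : fieldType) (V : cmodule k) (I : finType)
    (S : I -> submodule V) n : GRing.submod_closed (cap_mem S n).
Proof.
split; first by apply/forallP=> i; exact: rpred0.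
move=> c x y /forallP Sx /forallP Sy; apply/forallP=> i.
by rewrite rpredD ?rpredZ ?Sx ?Sy.
Qed.
Fact cap_act (k : fieldType) (V : cmodule k) (I : finType)
    (S : I -> submodule V) m n (a : mor m n) x :
  x \in cap_mem S m -> cm_act V a x \in cap_mem S n.
Proof. by move=> /forallP Sx; apply/forallP=> i; exact: sub_act. Qed.
Definition cap_submodule (k : fieldType) (V : cmodule k) (I : finType)
    (S : I -> submodule V) : submodule V :=
  Submodule (cap_closed S) (@cap_act k V I S).

Definition ker_mem (k : fieldType) (V W : cmodule k) (f : cm_hom V W) n :
  {pred V n} := [pred x | f n x == 0].
Arguments ker_mem {k V W} f n : simpl never.
Fact ker_closed (k : fieldType) (V W : cmodule k) (f : cm_hom V W) n :
  GRing.submod_closed (ker_mem f n).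
Proof.
split=> [|c x y]; rewrite !inE ?linear0 // => /eqP fx /eqP fy.
by rewrite linearP fx fy scaler0 addr0.
Qed.
Fact ker_act (k : fieldType) (V W : cmodule k) (f : cm_hom V W) m n
    (a : mor m n) x : x \in ker_mem f m -> cm_act V a x \in ker_mem f n.
Proof. by rewrite !inE hom_nat => /eqP->; rewrite linear0. Qed.
Definition ker_submodule (k : fieldType) (V W : cmodule k) (f : cm_hom V W) :
    submodule V :=
  Submodule (ker_closed f) (@ker_act k V W f).

(* The submodule generated by v : V n, i.e., the smallest one containing v. *)
Definition gen_mem (k : fieldType) (V : cmodule k) n (v : V n) m :
    {pred V m} :=
  [pred x | `[< forall S : submodule V,
                  v \in sub_mem S n -> x \in sub_mem S m >]].
Arguments gen_mem {k V n} v m : simpl never.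
Fact gen_closed (k : fieldType) (V : cmodule k) n (v : V n) m :
  GRing.submod_closed (gen_mem v m).
Proof.
split; first by apply/asboolP=> S _; exact: rpred0.
move=> c x y /asboolP Sx /asboolP Sy; apply/asboolP=> S Sv.
by rewrite rpredD ?rpredZ ?Sx ?Sy.
Qed.
Fact gen_act (k : fieldType) (V : cmodule k) n (v : V n) m l (a : mor m l) x :
  x \in gen_mem v m -> cm_act V a x \in gen_mem v l.
Proof. by move=> /asboolP Sx; apply/asboolP=> S /Sx; exact: sub_act. Qed.
Definition gen_submodule (k : fieldType) (V : cmodule k) n (v : V n) :
    submodule V :=
  Submodule (gen_closed v) (@gen_act k V n v).

Lemma mem_gen (k : fieldType) (V : cmodule k) n (v : V n) :
  v \in sub_mem (gen_submodule v) n.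
Proof. exact/asboolP. Qed.
Definition gen_elt (k : fieldType) (V : cmodule k) n (v : V n) :
    sub_cmodule (gen_submodule v) n :=
  SubCarrier (mem_gen v).

(* Elements of M(n)_m are functions C([n], [m]) -> k, a finitely supported
   k-linear combination of morphisms being identified with its coefficients. *)
Definition delta (k : fieldType) n m (b : mor n m) : {ffun mor n m -> k^o} :=
  [ffun c => (c == b)%:R].

Definition lin_ext (k : fieldType) n m (W : lmodType k) (F : mor n m -> W)
    (x : {ffun mor n m -> k^o}) : W := \sum_b (x b : k) *: F b.
Fact lin_ext_linear (k : fieldType) n m (W : lmodType k) (F : mor n m -> W) :
  linear (lin_ext F).
Proof.
move=> c x y; rewrite /lin_ext scaler_sumr -big_split; apply: eq_bigr => b _.
by rewrite !ffunE scalerDl scalerA.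
Qed.
HB.instance Definition _ (k : fieldType) n m (W : lmodType k)
    (F : mor n m -> W) :=
  GRing.isLinear.Build k {ffun mor n m -> k^o} W *:%R (lin_ext F)
    (lin_ext_linear F).

Lemma lin_ext_delta (k : fieldType) n m (W : lmodType k) (F : mor n m -> W) b :
  lin_ext F (delta k b) = F b.
Proof.
rewrite /lin_ext (bigD1 b) //= ffunE eqxx scale1r big1 ?addr0 // => c cb.
by rewrite ffunE (negPf cb) scale0r.
Qed.

Lemma lin_ext_id (k : fieldType) n m x : lin_ext (@delta k n m) x = x.
Proof.
apply/ffunP=> c; rewrite /lin_ext sum_ffunE (bigD1 c) //= big1 => [|b bc].
  by rewrite !ffunE eqxx addr0 /GRing.scale/= mulr1.
by rewrite !ffunE eq_sym (negPf bc) scaler0.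
Qed.

Definition free_act (k : fieldType) n m l (a : mor m l) :
    {linear {ffun mor n m -> k^o} -> {ffun mor n l -> k^o}} :=
  lin_ext (fun b => delta k (mor_comp a b)).

Fact free_act1 (k : fieldType) n m x : free_act k n (mor_id m) x = x.
Proof.
rewrite -[RHS]lin_ext_id; by apply: eq_bigr => b _; rewrite mor_comp1m.
Qed.
Fact free_actM (k : fieldType) n l m p (b : mor m p) (a : mor l m) x :
  free_act k n (mor_comp b a) x = free_act k n b (free_act k n a x).
Proof.
rewrite [free_act k n a x]/(lin_ext _ x) linear_sum; apply: eq_bigr => c _.
by rewrite linearZ /free_act /= lin_ext_delta mor_compA.
Qed.
Definition free_cmodule (k : fieldType) (n : nat) : cmodule k :=
  @CModule k (fun m => {ffun mor n m -> k^o}) (@free_act k n)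
    (@free_act1 k n) (@free_actM k n).

Definition free_gen (k : fieldType) n : free_cmodule k n n := delta k (mor_id n).

Definition free_hom_fun (k : fieldType) n (V : cmodule k) (v : V n) m :
    {linear free_cmodule k n m -> V m} :=
  lin_ext (fun b => cm_act V b v).
Fact free_hom_nat (k : fieldType) n (V : cmodule k) (v : V n) m l
    (a : mor m l) x :
  free_hom_fun v l (cm_act (free_cmodule k n) a x) =
  cm_act V a (free_hom_fun v m x).
Proof.
rewrite [cm_act (free_cmodule k n) a x]/(lin_ext _ x) !linear_sum.
apply: eq_bigr => c _.
by rewrite !linearZ /free_hom_fun /= lin_ext_delta cm_actM.
Qed.
(* The unique homomorphism M(n) -> V with e_n |-> v. *)
Definition free_hom (k : fieldType) n (V : cmodule k) (v : V n) :
    cm_hom (free_cmodule k n) V :=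
  CMHom (@free_hom_nat k n V v).

Lemma free_hom_gen (k : fieldType) n (V : cmodule k) (v : V n) :
  free_hom v n (free_gen k n) = v.
Proof. by rewrite /free_hom /= lin_ext_delta cm_act1. Qed.

Definition skip_elt (k : fieldType) m (i : 'I_m.+1) : free_cmodule k m m.+1 :=
  delta k (skip i).

(* f_i : M(n) -> kC alpha_{n-1,i}, e_n |-> alpha_{n-1,i}, for n = m + 1 *)
Definition f_hom (k : fieldType) m (i : 'I_m.+1) :
    cm_hom (free_cmodule k m.+1)
           (sub_cmodule (gen_submodule (skip_elt k i))) :=
  free_hom (gen_elt (skip_elt k i)).

Lemma f_homE (k : fieldType) m (i : 'I_m.+1) l (b : mor m.+1 l) :
  sub_val (f_hom k i l (delta k b)) = delta k (mor_comp b (skip i)).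
Proof. by rewrite /f_hom /free_hom /= lin_ext_delta /= lin_ext_delta. Qed.

Definition K (k : fieldType) m (i : 'I_m.+1) : submodule (free_cmodule k m.+1) :=
  ker_submodule (f_hom k i).

Definition cap_K (k : fieldType) (n : nat) : submodule (free_cmodule k n) :=
  match n with
  | 0 => full_submodule (free_cmodule k 0)
  | m.+1 => cap_submodule (@K k m)
  end.

(* Main.v *)
Require Import Defs.
From HB Require Import structures.
From mathcomp Require Import all_boot all_order all_algebra.
From mathcomp Require Import boolp zify.

(** The category of increasing maps has amalgamation: two maps out of [l] can
    be completed to a commutative square.  Hence torsion elements, and more
    generally the elements that some morphism sends into a given submodule, form
    submodules, and a module V is saturated exactly when it is a sheaf for the
    atomic topology: morphisms act injectively ([torsion_free]), and every
    element on which morphisms agreeing along a have the same effect comes from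
    a unique element along a ([has_descent]).  This is [saturatedP].  Descent
    gives a retraction of an extension of a torsion module by V; conversely,
    applying Ext^1 = 0 to the torsion part of the cokernel of V in a product of
    its values produces the descended element.  The free modules are sheaves,
    and so are the kernels of maps between them.  From here on a saturated
    submodule of M(n) is a submodule S such that a x in S implies x in S.

    The intersection C(n) of the kernels contains the alternating element
    [alt] = sum over e in {0,1}^n of (-1)^|e| [2i + e_i], that is, the product
    over i of (position 2i minus position 2i+1).  Two facts carry the theorem.
    - Every nonzero saturated S in M(n) contains [alt]: if the coefficient of v
      at b is nonzero, double all the points and take the alternating sum over
      the choices of copies of the points of b.  A basis element that misses
      one of these points cancels out, so that only the translate of [alt]
      along b survives ([alt_in_sat_closed]).
    - [alt] generates C(n) up to torsion: for w in C(n), send each point to the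
      upper of its two copies and replace each b by the product over i of
      (upper copy of b_i minus lower copy of b_(i+1)), a translate of [alt].
      Expanding sum_b w(b) (product) gives the image of w, because each mixed
      term is independent of some b_i and is killed by the i-th kernel
      condition ([alt_span_cap_K]).
    So every nonzero saturated submodule of M(n) contains C(n)
    ([cap_K_minimal]), and simplicity follows.

    For the classification, a simple saturated V receives a nonzero map from
    some M(n).  View it as a functional relation between M(n) and V.  If its
    restriction to C(n) vanishes, restrict it to successive kernels as
    long as it stays nonzero, and push it forward along the next face map: the
    result is a nonzero functional relation between M(n-1) and V
    ([subquotient_cap_K]).  Eventually some functional relation is nonzero on
    some C(n); by [cap_K_minimal] its saturation is total and injective there,
    so that it is a monomorphism C(n) -> V, which must be an isomorphism. *)

Set Implicit Arguments.
Unset Strict Implicit.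
Unset Printing Implicit Defensive.
Import Defs GRing.Theory.

(** * Increasing maps and their amalgamation *)

Lemma increasing_fun m n (f : 'I_m -> 'I_n) :
  {homo f : i j / i < j} -> increasing [ffun i => f i].
Proof.
move=> fP; apply/forallP=> i; apply/forallP=> j; rewrite !ffunE.
exact/implyP/fP.
Qed.

Fact nat_mor_subproof m n (f : nat -> nat)
    (f_incr : forall i j, i < j < m -> f i < f j)
    (f_lt : forall i, i < m -> f i < n) :
  increasing [ffun i : 'I_m => Ordinal (f_lt i (ltn_ord i))].
Proof.
by apply: increasing_fun => i j ij; apply: f_incr; rewrite ij ltn_ord.
Qed.
Definition nat_mor m n (f : nat -> nat)
    (f_incr : forall i j, i < j < m -> f i < f j)
    (f_lt : forall i, i < m -> f i < n) : mor m n :=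
  Mor (nat_mor_subproof f_incr f_lt).

Lemma nat_morE m n (f : nat -> nat) f_incr f_lt i :
  @nat_mor m n f f_incr f_lt i = f i :> nat.
Proof. by rewrite /= ffunE. Qed.

Lemma mor_nat_eqP m n (a b : mor m n) : (forall i, a i = b i :> nat) -> a = b.
Proof. by move=> ab; apply: mor_eqP => i; apply/val_inj/ab. Qed.

Lemma mor_mono m n (a : mor m n) (i j : 'I_m) : (a i <= a j) = (i <= j).
Proof.
case: (ltnP j i) => [/(mor_lt a)|]; first by rewrite ltnNge => /negbTE.
by rewrite leq_eqVlt => /predU1P[/val_inj->|/(mor_lt a)/ltnW]; rewrite ?leqnn.
Qed.

Lemma mor_inj m n (a : mor m n) : injective a.
Proof.
move=> i j aij; apply/val_inj/eqP.
by rewrite eqn_leq -!(mor_mono a) aij leqnn.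
Qed.

Lemma mor_leq m n (a : mor m n) : m <= n.
Proof. by have := leq_card a (@mor_inj _ _ a); rewrite !card_ord. Qed.

(** A point x of [m] is moved up by the value of b at the last point of [l] that
    a sends to x or below.  At a point a i this gives a i + b i, which is
    symmetric in a and b: the two legs of the square agree on [l]. *)
Definition amalg_fun l m n (a : mor l m) (b : mor l n) (x : nat) : nat :=
  x + \max_(i < l | a i <= x) b i.

Lemma amalg_fun_incr l m n (a : mor l m) (b : mor l n) x y :
  x < y < m -> amalg_fun a b x < amalg_fun a b y.
Proof.
case/andP=> xy _; rewrite /amalg_fun -addSn leq_add //.
apply/bigmax_leqP=> i ix; apply: leq_bigmax_cond.
exact: leq_trans ix (ltnW xy).
Qed.

Lemma amalg_fun_lt l m n (a : mor l m) (b : mor l n) x :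
  x < m -> amalg_fun a b x < m + n.
Proof.
move=> xm; rewrite /amalg_fun -addSn leq_add //.
by apply/bigmax_leqP=> i _; apply/ltnW.
Qed.

Definition amalg l m n (a : mor l m) (b : mor l n) : mor m (m + n) :=
  nat_mor (@amalg_fun_incr l m n a b) (@amalg_fun_lt l m n a b).

Lemma amalgE l m n (a : mor l m) (b : mor l n) i :
  amalg a b (a i) = (a i + b i) :> nat.
Proof.
rewrite nat_morE /amalg_fun; congr (_ + _); apply/eqP.
rewrite eqn_leq; apply/andP; split; last exact: leq_bigmax_cond.
by apply/bigmax_leqP=> j; rewrite !mor_mono.
Qed.

Lemma amalgamation l m n (a : mor l m) (b : mor l n) :
  exists p (c : mor m p) (d : mor n p), mor_comp c a = mor_comp d b.
Proof.
have lt x : x < n -> amalg_fun b a x < m + n.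
  by rewrite addnC; apply: amalg_fun_lt.
exists (m + n), (amalg a b), (nat_mor (@amalg_fun_incr l n m b a) lt).
apply: mor_nat_eqP => i; rewrite !mor_compE amalgE addnC.
by rewrite -(amalgE b a) !nat_morE.
Qed.

Lemma mor_factor m n l (a : mor m l) (c : mor n l) :
  (forall i, c i \in codom a) -> exists b, c = mor_comp a b.
Proof.
move=> ca; pose f i := iinv (ca i).
have fE i : a (f i) = c i by rewrite f_iinv.
have f_incr : {homo f : i j / i < j >-> (i < j)%N}%N.
  by move=> i j ij; rewrite ltnNge -(mor_mono a) !fE mor_mono -ltnNge.
exists (Mor (increasing_fun f_incr)).
by apply: mor_eqP => i; rewrite mor_compE ffunE fE.
Qed.

Lemma mor_gap m n (a : mor m n) d (i j : 'I_m) :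
  j = (i + d)%N :> nat -> (a i + d <= a j)%N.
Proof.
elim: d j => [|d IHd] j; first by rewrite !addn0 => /val_inj->.
rewrite !addnS => jE; have lt : (i + d < m)%N by rewrite -jE ltnW.
have /leq_ltn_trans := IHd (Ordinal lt) erefl; apply.
by apply: mor_lt; rewrite /= jE.
Qed.

Lemma mor_endo_id n (a : mor n n) : a = mor_id n.
Proof.
apply: mor_nat_eqP => i; rewrite /= ffunE; case: n a i => [? []//|n] a i.
have := mor_gap a (i := ord0) (j := i) (erefl _).
have := mor_gap a (i := i) (j := ord_max) (esym (subnKC (leq_ord i))).
have := ltn_ord (a ord_max); have := ltn_ord i; lia.
Qed.

(** Distinct n-element subsets of [m] are not contained in each other. *)
Lemma mor_missing n m (b c : mor n m) : c != b -> exists i, b i \notin codom c.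
Proof.
move=> cb; apply/existsP; apply: contraR cb; rewrite negb_exists.
move=> /forallP bc; have [i|a ->] := @mor_factor _ _ _ c b.
  by have := bc i; rewrite negbK.
by rewrite (mor_endo_id a) mor_compm1.
Qed.

Local Open Scope ring_scope.

(** * Homomorphisms and submodules *)

Definition hom_of (k : fieldType) (V W : cmodule k)
    (f : forall n, V n -> W n) (f_lin : forall n, linear (f n))
    (f_nat : forall m n (a : mor m n) x,
       f n (cm_act V a x) = cm_act W a (f m x)) : cm_hom V W :=
  @CMHom k V W
    (fun n => HB.pack (f n)
       (GRing.isLinear.Build k (V n) (W n) *:%R (f n) (f_lin n)))
    f_nat.

Definition submodule_of (k : fieldType) (V : cmodule k)
    (P : forall n, V n -> Prop) (P0 : forall n, P n 0)
    (P_lin : forall n c x y, P n x -> P n y -> P n (c *: x + y))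
    (P_act : forall m n (a : mor m n) x, P m x -> P n (cm_act V a x)) :
  submodule V.
Proof.
apply: (@Submodule k V (fun n => [pred x | `[<P n x>]])).
  move=> n; split=> [|c x y /asboolP Px /asboolP Py]; apply/asboolP => //.
  exact: P_lin.
by move=> m n a x /asboolP Px; apply/asboolP/P_act.
Defined.

Lemma in_submodule_of (k : fieldType) (V : cmodule k)
    (P : forall n, V n -> Prop) P0 P_lin P_act n (x : V n) :
  x \in sub_mem (@submodule_of k V P P0 P_lin P_act) n <-> P n x.
Proof. by split=> [/asboolP|Px] //; exact/asboolP. Qed.

Definition sub_incl (k : fieldType) (V : cmodule k) (S : submodule V) :
    cm_hom (sub_cmodule S) V :=
  @hom_of k (sub_cmodule S) V (fun n x => sub_val x)
    (fun n c x y => erefl) (fun m n a x => erefl).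

Lemma bij_hom_iso (k : fieldType) (V W : cmodule k) (f : cm_hom V W) :
  (forall n, injective (f n)) -> (forall n y, exists x, f n x = y) -> cm_iso f.
Proof.
move=> f_inj f_surj; pose g n y := sval (cid (f_surj n y)).
have gK n y : f n (g n y) = y by exact: svalP (cid (f_surj n y)).
have g_lin n : linear (g n).
  by move=> c x y; apply: f_inj; rewrite linearP !gK.
have g_nat m n (a : mor m n) y : g n (cm_act W a y) = cm_act V a (g m y).
  by apply: f_inj; rewrite hom_nat !gK.
exists (hom_of g_lin g_nat); split=> [n x|n y]; last exact: gK.
exact/f_inj/gK.
Qed.

Lemma cm_iso_sym (k : fieldType) (V W : cmodule k) (f : cm_hom V W) :
  cm_iso f -> isomorphic W V.
Proof. by case=> g [gf fg]; exists g, f. Qed.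

Definition comp_hom (k : fieldType) (U V W : cmodule k) (g : cm_hom V W)
    (f : cm_hom U V) : cm_hom U W.
Proof.
apply: (@hom_of k U W (fun n x => g n (f n x))).
- by move=> n c x y; rewrite !linearP.
- by move=> m n a x; rewrite !hom_nat.
Defined.

Definition hom_image (k : fieldType) (V W : cmodule k) (f : cm_hom V W) :
  submodule W.
Proof.
apply: (@submodule_of k W (fun n y => exists x, f n x = y)).
- by move=> n; exists 0; rewrite linear0.
- by move=> n c _ _ [x <-] [y <-]; exists (c *: x + y); rewrite linearP.
- by move=> m n a _ [x <-]; exists (cm_act V a x); rewrite hom_nat.
Defined.

Lemma in_hom_image (k : fieldType) (V W : cmodule k) (f : cm_hom V W) n
    (y : W n) :
  y \in sub_mem (hom_image f) n <-> exists x, f n x = y.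
Proof. exact: in_submodule_of. Qed.

(** * Saturation of a submodule *)

(** Equivalently, the quotient of V by S is torsion-free. *)
Definition sat_closed (k : fieldType) (V : cmodule k) (S : submodule V) :
    Prop :=
  forall m n (a : mor m n) x,
    cm_act V a x \in sub_mem S n -> x \in sub_mem S m.

Definition in_saturation (k : fieldType) (V : cmodule k) (S : submodule V) n
    (x : V n) : Prop :=
  exists m (a : mor n m), cm_act V a x \in sub_mem S m.

(** Amalgamation makes the witness of membership in the saturation as large as
    desired: it can be taken to factor through any given morphism.  This is what
    makes the saturation a submodule. *)
Lemma in_saturation_amalg (k : fieldType) (V : cmodule k) (S : submodule V)
    m n p (x : V n) (a : mor n m) (b : mor n p) :
  cm_act V a x \in sub_mem S m ->
  exists q (c : mor p q), cm_act V c (cm_act V b x) \in sub_mem S q.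
Proof.
move=> Sax; have [q [c [d cd]]] := amalgamation b a; exists q, c.
by rewrite -cm_actM cd cm_actM sub_act.
Qed.

Lemma in_saturation0 (k : fieldType) (V : cmodule k) (S : submodule V) n :
  in_saturation S (0 : V n).
Proof. by exists n, (mor_id n); rewrite linear0 rpred0. Qed.

Lemma in_saturation_act (k : fieldType) (V : cmodule k) (S : submodule V) m n
    (a : mor m n) x : in_saturation S x -> in_saturation S (cm_act V a x).
Proof.
case=> p [b Sbx]; have [q [c Scx]] := in_saturation_amalg a Sbx.
by exists q, c.
Qed.

Lemma in_saturation_lin (k : fieldType) (V : cmodule k) (S : submodule V) n c
    (x y : V n) :
  in_saturation S x -> in_saturation S y -> in_saturation S (c *: x + y).
Proof.
case=> p [a Sax] [q [b Sby]].
have [r [d Sdbx]] := in_saturation_amalg b Sax.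
exists r, (mor_comp d b).
rewrite linearP rpredD //; first by rewrite rpredZ // cm_actM.
by rewrite cm_actM sub_act.
Qed.

Definition saturation (k : fieldType) (V : cmodule k) (S : submodule V) :
    submodule V :=
  submodule_of (in_saturation0 S) (@in_saturation_lin k V S)
    (@in_saturation_act k V S).

Lemma in_saturationP (k : fieldType) (V : cmodule k) (S : submodule V) n
    (x : V n) :
  x \in sub_mem (saturation S) n <-> in_saturation S x.
Proof. exact: in_submodule_of. Qed.

Lemma saturation_closed (k : fieldType) (V : cmodule k) (S : submodule V) :
  sat_closed (saturation S).
Proof.
move=> m n a x /in_saturationP[p [b Sbx]]; apply/in_saturationP.
by exists p, (mor_comp b a); rewrite cm_actM.
Qed.

Lemma sub_saturation (k : fieldType) (V : cmodule k) (S : submodule V) n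
    (x : V n) :
  x \in sub_mem S n -> x \in sub_mem (saturation S) n.
Proof.
by move=> Sx; apply/in_saturationP; exists n, (mor_id n); rewrite cm_act1.
Qed.

(** * Functional relations between modules *)

(** Submodules of a direct sum serve as partially defined homomorphisms.  This
    spares forming quotient modules: restricting, pushing forward and saturating
    a homomorphism only change the relation. *)
Definition functional (k : fieldType) (V W : cmodule k)
    (R : submodule (dsum V W)) : Prop :=
  forall n (y : W n), ((0, y) : dsum V W n) \in sub_mem R n -> y = 0.

Lemma functional_eq (k : fieldType) (V W : cmodule k)
    (R : submodule (dsum V W)) n (x : V n) (y z : W n) :
  functional R -> ((x, y) : dsum V W n) \in sub_mem R n ->
  ((x, z) : dsum V W n) \in sub_mem R n -> y = z.
Proof.
move=> Rf Rxy Rxz; apply/eqP; rewrite -subr_eq0; apply/eqP/Rf.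
by have := rpredB Rxy Rxz; rewrite -[_ - _]/(x - x, y - z) subrr.
Qed.

Lemma hom_of_graph (k : fieldType) (V W : cmodule k)
    (R : submodule (dsum V W)) :
  functional R ->
  (forall n x, exists y, ((x, y) : dsum V W n) \in sub_mem R n) ->
  exists f : cm_hom V W,
    forall n x, ((x, f n x) : dsum V W n) \in sub_mem R n.
Proof.
move=> Rf Rt; pose f n x := sval (cid (Rt n x)).
have fR n x : ((x, f n x) : dsum V W n) \in sub_mem R n.
  exact: svalP (cid (Rt n x)).
have f_lin n : linear (f n).
  move=> c x y; apply: (functional_eq Rf (fR n _)).
  exact: rpredD (rpredZ c (fR n x)) (fR n y).
have f_nat m n (a : mor m n) x : f n (cm_act V a x) = cm_act W a (f m x).
  exact: (functional_eq Rf (fR n _)) (sub_act a (fR m x)).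
by exists (hom_of f_lin f_nat).
Qed.

(** * Descent implies saturation *)

Definition torsion_free (k : fieldType) (V : cmodule k) : Prop :=
  forall m n (a : mor m n) (x : V m), cm_act V a x = 0 -> x = 0.

Definition has_descent (k : fieldType) (V : cmodule k) : Prop :=
  forall m n (a : mor m n) (v : V n),
    (forall p (b c : mor n p), mor_comp b a = mor_comp c a ->
       cm_act V b v = cm_act V c v) ->
    exists u : V m, cm_act V a u = v.

Definition sheaf (k : fieldType) (V : cmodule k) : Prop :=
  torsion_free V /\ has_descent V.

Lemma torsion_free_inj (k : fieldType) (V : cmodule k) m n (a : mor m n) :
  torsion_free V -> injective (cm_act V a).
Proof.
move=> Vtf x y /eqP; rewrite -subr_eq0 -linearB => /eqP/Vtf/eqP.
by rewrite subr_eq0 => /eqP.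
Qed.

Lemma torsion_eltP (k : fieldType) (V : cmodule k) n (x : V n) :
  torsion_elt x <-> exists m (a : mor n m), cm_act V a x = 0.
Proof.
split=> [[s [a ax]]|[m [a ax]]]; first by exists (n + s)%N, a.
have := subnKC (mor_leq a); move: (m - n)%N => s m_def.
by subst m; exists s, a.
Qed.

(** An element x of an extension E of a torsion module T by V is moved into V by
    some morphism a, and descent along a returns an element of V.  This element
    does not depend on a, so that it defines a retraction of E onto V. *)
Lemma sheaf_saturated (k : fieldType) (V : cmodule k) : sheaf V -> saturated V.
Proof.
case=> Vtf Vd T Ttor; split=> [f n x|E].
  have [m [a ax]] := (torsion_eltP x).1 (Ttor n x).
  by apply: (Vtf _ _ a); rewrite -hom_nat ax linear0.
set M := ext_mid E.
pose G0 n (z : dsum M V n) := z.1 = ext_in E n z.2.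
have in0 n : ext_in E n 0 = 0 by rewrite linear0.
have G00 n : G0 n 0 := esym (in0 n).
have G0_lin n c x y : G0 n x -> G0 n y -> G0 n (c *: x + y).
  by rewrite /G0 /= linearP => -> ->.
have G0_act m n (a : mor m n) x : G0 m x -> G0 n (cm_act _ a x).
  by rewrite /G0 /= hom_nat => ->.
pose G := submodule_of G00 G0_lin G0_act.
have Gf : functional (saturation G).
  move=> n y /in_saturationP[m [a /in_submodule_of]]; rewrite /G0/= linear0.
  by rewrite -(in0 m) => /ext_in_inj/esym; apply: Vtf.
have Gt n x : exists y, ((x, y) : dsum M V n) \in sub_mem (saturation G) n.
  have [m [a ax]] := (torsion_eltP (ext_pr E n x)).1 (Ttor _ _).
  move: ax; rewrite -hom_nat => /ext_exact[v v_ax].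
  (* a x comes from v; as morphisms agreeing along a agree on a x, they agree
     on v, which therefore descends. *)
  have [p b c bc|u u_v] := Vd _ _ a v.
    by apply: (@ext_in_inj _ _ _ E); rewrite !hom_nat v_ax -!cm_actM bc.
  exists u; apply/in_saturationP; exists m, a; apply/in_submodule_of.
  by rewrite /G0/= /dsum_act_fun/= u_v v_ax.
have [r rG] := hom_of_graph Gf Gt.
have phi_lin n : linear (fun x : M n => (r n x, ext_pr E n x)).
  by move=> c x y; rewrite !linearP.
have phi_nat m n (a : mor m n) (x : M m) :
    (r n (cm_act M a x), ext_pr E n (cm_act M a x)) =
    cm_act (dsum V T) a (r m x, ext_pr E m x).
  by rewrite !hom_nat.
exists (@hom_of k M (dsum V T) _ phi_lin phi_nat); split=> // n v.
congr (_, _); last by apply/ext_exact; exists v.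
apply: (functional_eq Gf (rG n _)).
by apply: sub_saturation; apply/in_submodule_of.
Qed.

(** * Saturation implies descent *)

Definition zero_submodule (k : fieldType) (V : cmodule k) : submodule V :=
  ker_submodule (@hom_of k V V (fun n x => x) (fun n c x y => erefl)
    (fun m n a x => erefl)).

Definition torsion_part (k : fieldType) (V : cmodule k) : submodule V :=
  saturation (zero_submodule V).

Lemma torsion_partP (k : fieldType) (V : cmodule k) n (x : V n) :
  x \in sub_mem (torsion_part V) n <-> exists m (a : mor n m), cm_act V a x = 0.
Proof.
split=> [/in_saturationP[m [a /eqP ax]]|[m [a ax]]]; first by exists m, a.
by apply/in_saturationP; exists m, a; apply/eqP.
Qed.

Lemma torsion_part_torsion (k : fieldType) (V : cmodule k) :
  torsion (sub_cmodule (torsion_part V)).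
Proof.
move=> n x; have /torsion_partP[m [a ax]] := sub_valP x.
by apply/torsion_eltP; exists m, a; apply/val_inj.
Qed.

Lemma saturated_torsion_free (k : fieldType) (V : cmodule k) :
  saturated V -> torsion_free V.
Proof.
move=> Vsat m n a x ax.
have Tx : x \in sub_mem (torsion_part V) m by apply/torsion_partP; exists n, a.
have [homT _] := Vsat _ (@torsion_part_torsion k V).
exact: (homT (sub_incl _) m (SubCarrier Tx)).
Qed.

(** The product over all a : [p] -> [q] of V_q contains V_p through
    x |-> (a x)_a.  This embedding is split, as a map of vector spaces, by the
    value at the identity; so its cokernel is represented by the cochains that
    vanish at the identity ([ncochain]), and needs no quotient type. *)
Definition cochain (k : fieldType) (V : cmodule k) p : Type :=
  forall q, mor p q -> V q.

HB.instance Definition _ (k : fieldType) (V : cmodule k) p :=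
  gen_eqMixin (cochain V p).
HB.instance Definition _ (k : fieldType) (V : cmodule k) p :=
  gen_choiceMixin (cochain V p).

Lemma cochainP (k : fieldType) (V : cmodule k) p (v w : cochain V p) :
  (forall q (a : mor p q), v q a = w q a) -> v = w.
Proof.
by move=> vw; apply: functional_extensionality_dep => q; apply/funext.
Qed.

Fact cochain_addA (k : fieldType) (V : cmodule k) p :
  associative (fun (v w : cochain V p) q a => v q a + w q a).
Proof. by move=> u v w; apply: cochainP => q a; rewrite addrA. Qed.
Fact cochain_addC (k : fieldType) (V : cmodule k) p :
  commutative (fun (v w : cochain V p) q a => v q a + w q a).
Proof. by move=> v w; apply: cochainP => q a; rewrite addrC. Qed.
Fact cochain_add0 (k : fieldType) (V : cmodule k) p :
  left_id (fun q a => 0) (fun (v w : cochain V p) q a => v q a + w q a).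
Proof. by move=> v; apply: cochainP => q a; rewrite add0r. Qed.
Fact cochain_addN (k : fieldType) (V : cmodule k) p :
  left_inverse (fun q a => 0) (fun (v : cochain V p) q a => - v q a)
    (fun v w q a => v q a + w q a).
Proof. by move=> v; apply: cochainP => q a; rewrite addNr. Qed.
HB.instance Definition _ (k : fieldType) (V : cmodule k) p :=
  GRing.isZmodule.Build (cochain V p) (@cochain_addA k V p)
    (@cochain_addC k V p) (@cochain_add0 k V p) (@cochain_addN k V p).

Definition cochain_scale (k : fieldType) (V : cmodule k) p (c : k)
    (v : cochain V p) : cochain V p := fun q a => c *: v q a.
Fact cochain_scaleA (k : fieldType) (V : cmodule k) p c d (v : cochain V p) :
  cochain_scale c (cochain_scale d v) = cochain_scale (c * d) v.
Proof. by apply: cochainP => q a; apply: scalerA. Qed.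
Fact cochain_scale1 (k : fieldType) (V : cmodule k) p :
  left_id 1 (@cochain_scale k V p).
Proof. by move=> v; apply: cochainP => q a; apply: scale1r. Qed.
Fact cochain_scaleDr (k : fieldType) (V : cmodule k) p :
  right_distributive (@cochain_scale k V p) +%R.
Proof. by move=> c v w; apply: cochainP => q a; apply: scalerDr. Qed.
Fact cochain_scaleDl (k : fieldType) (V : cmodule k) p (v : cochain V p) :
  {morph (@cochain_scale k V p)^~ v : c d / c + d}.
Proof. by move=> c d; apply: cochainP => q a; apply: scalerDl. Qed.
HB.instance Definition _ (k : fieldType) (V : cmodule k) p :=
  GRing.Zmodule_isLmodule.Build k (cochain V p) (@cochain_scaleA k V p)
    (@cochain_scale1 k V p) (@cochain_scaleDr k V p) (@cochain_scaleDl k V p).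

Definition normalized (k : fieldType) (V : cmodule k) p : {pred cochain V p} :=
  [pred w : cochain V p | w p (mor_id p) == 0].
Arguments normalized {k} V p : simpl never.
Fact normalized_closed (k : fieldType) (V : cmodule k) p :
  GRing.submod_closed (normalized V p).
Proof.
split=> [|c v w]; rewrite !inE //= => /eqP v0 /eqP w0.
by rewrite -[_ p _]/(c *: v p _ + w p _) v0 w0 scaler0 addr0.
Qed.
HB.instance Definition _ (k : fieldType) (V : cmodule k) p :=
  GRing.isSubmodClosed.Build k (cochain V p) (normalized V p)
    (@normalized_closed k V p).

Record ncochain (k : fieldType) (V : cmodule k) p := NCochain {
  nc_val :> cochain V p;
  nc_valP : nc_val \in normalized V p
}.
Arguments nc_val {k V p} n.
HB.instance Definition _ (k : fieldType) (V : cmodule k) p :=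
  [isSub for @nc_val k V p].
HB.instance Definition _ (k : fieldType) (V : cmodule k) p :=
  [Choice of ncochain V p by <:].
HB.instance Definition _ (k : fieldType) (V : cmodule k) p :=
  [SubChoice_isSubLmodule of ncochain V p by <:].

(** Precomposition with b makes w b the value at the identity; subtracting the
    image of this element of V_q normalizes the result without changing its
    class in the cokernel. *)
Definition nc_act_fun (k : fieldType) (V : cmodule k) p q (b : mor p q)
    (w : cochain V p) : cochain V q :=
  fun r a => w r (mor_comp a b) - cm_act V a (w q b).
Fact nc_act_normalized (k : fieldType) (V : cmodule k) p q (b : mor p q)
    (w : ncochain V p) : nc_act_fun b w \in normalized V q.
Proof. by rewrite inE /nc_act_fun mor_comp1m cm_act1 subrr. Qed.
Definition nc_act (k : fieldType) (V : cmodule k) p q (b : mor p q)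
    (w : ncochain V p) : ncochain V q := NCochain (nc_act_normalized b w).
Fact nc_act_linear (k : fieldType) (V : cmodule k) p q (b : mor p q) :
  linear (@nc_act k V p q b).
Proof.
move=> c v w; apply/val_inj/cochainP => r a.
rewrite -[LHS]/(c *: nc_val v r _ + nc_val w r _ -
  cm_act V a (c *: nc_val v q b + nc_val w q b)).
by rewrite linearP opprD addrACA -scalerBr.
Qed.
HB.instance Definition _ (k : fieldType) (V : cmodule k) p q (b : mor p q) :=
  GRing.isLinear.Build k (ncochain V p) (ncochain V q) *:%R (@nc_act k V p q b)
    (@nc_act_linear k V p q b).
Fact nc_act1 (k : fieldType) (V : cmodule k) p (w : ncochain V p) :
  nc_act (mor_id p) w = w.
Proof.
apply/val_inj/cochainP => r a; rewrite /= /nc_act_fun mor_compm1.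
by have /eqP-> := nc_valP w; rewrite linear0 subr0.
Qed.
Fact nc_actM (k : fieldType) (V : cmodule k) p q r (c : mor q r) (b : mor p q)
    (w : ncochain V p) : nc_act (mor_comp c b) w = nc_act c (nc_act b w).
Proof.
apply/val_inj/cochainP => s a; rewrite /= /nc_act_fun mor_compA cm_actM.
by rewrite linearB opprB addrA subrK.
Qed.
Definition nc_cmodule (k : fieldType) (V : cmodule k) : cmodule k :=
  @CModule k (ncochain V) (fun p q b => @nc_act k V p q b) (@nc_act1 k V)
    (@nc_actM k V).

(** The preimage, in the product, of a submodule S of the cokernel, written as
    V_p x S_p by means of the splitting: normalizing b w subtracts the image of
    w b, and this is the term that twists the action. *)
Definition tw_obj (k : fieldType) (V : cmodule k)
  (S : submodule (nc_cmodule V)) p : lmodType k := dsum V (sub_cmodule S) p.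
Definition tw_act (k : fieldType) (V : cmodule k)
    (S : submodule (nc_cmodule V)) p q (b : mor p q) (z : tw_obj S p) :
    tw_obj S q :=
  (cm_act V b z.1 + nc_val (sub_val z.2) q b, cm_act (sub_cmodule S) b z.2).
Fact tw_act_linear (k : fieldType) (V : cmodule k)
    (S : submodule (nc_cmodule V)) p q (b : mor p q) :
  linear (@tw_act k V S p q b).
Proof.
move=> c x y; congr (_, _); last by rewrite linearP.
rewrite -[X in _ + X]/(c *: nc_val (sub_val x.2) q b +
  nc_val (sub_val y.2) q b).
by rewrite /= linearP addrACA -scalerDr.
Qed.
HB.instance Definition _ (k : fieldType) (V : cmodule k)
    (S : submodule (nc_cmodule V)) p q (b : mor p q) :=
  GRing.isLinear.Build k (tw_obj S p) (tw_obj S q) *:%R (@tw_act k V S p q b)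
    (@tw_act_linear k V S p q b).
Fact tw_act1 (k : fieldType) (V : cmodule k) (S : submodule (nc_cmodule V)) p
    (z : tw_obj S p) : tw_act (mor_id p) z = z.
Proof.
case: z => x t; congr (_, _); last exact: (cm_act1 t).
by have /eqP-> := nc_valP (sub_val t); rewrite cm_act1 addr0.
Qed.
Fact tw_actM (k : fieldType) (V : cmodule k) (S : submodule (nc_cmodule V))
    p q r (c : mor q r) (b : mor p q) (z : tw_obj S p) :
  tw_act (mor_comp c b) z = tw_act c (tw_act b z).
Proof.
case: z => x t; congr (_, _); last exact: (cm_actM c b t).
rewrite -[X in _ = _ + X]/(nc_val (sub_val t) r (mor_comp c b) -
  cm_act V c (nc_val (sub_val t) q b)).
by rewrite /= cm_actM linearD -addrA [X in _ = _ + X]addrC subrK.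
Qed.
Definition tw_cmodule (k : fieldType) (V : cmodule k)
    (S : submodule (nc_cmodule V)) : cmodule k :=
  @CModule k (tw_obj S) (fun p q b => @tw_act k V S p q b) (@tw_act1 k V S)
    (@tw_actM k V S).

Fact tw_in_nat (k : fieldType) (V : cmodule k) (S : submodule (nc_cmodule V))
    m n (a : mor m n) (x : V m) :
  ((cm_act V a x, 0) : tw_obj S n) = tw_act a (x, 0).
Proof. by congr (_, _); rewrite ?linear0 //= addr0. Qed.
Definition tw_in (k : fieldType) (V : cmodule k)
    (S : submodule (nc_cmodule V)) :
    cm_hom V (tw_cmodule S) :=
  @CMHom k V (tw_cmodule S) (dsum_in1 V (sub_cmodule S)) (@tw_in_nat k V S).
Definition tw_pr (k : fieldType) (V : cmodule k)
    (S : submodule (nc_cmodule V)) :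
    cm_hom (tw_cmodule S) (sub_cmodule S) :=
  @CMHom k (tw_cmodule S) (sub_cmodule S) (dsum_pr2 V (sub_cmodule S))
    (fun _ _ _ _ => erefl).
Definition tw_extension (k : fieldType) (V : cmodule k)
    (S : submodule (nc_cmodule V)) : extension (sub_cmodule S) V :=
  @Extension k (sub_cmodule S) V (tw_cmodule S) (tw_in S) (tw_pr S)
    (@dsum_in1_inj k (sub_cmodule S) V) (@dsum_pr2_surj k (sub_cmodule S) V)
    (@dsum_exact k (sub_cmodule S) V).

(** Let v satisfy the descent condition along a. The cochain sending b a to b v,
    and the morphisms that do not factor through a to zero, becomes the image of
    v under a; so its class in the cokernel is torsion. A splitting of the
    corresponding extension maps it to an element of V that a sends to v. *)
Lemma saturated_has_descent (k : fieldType) (V : cmodule k) :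
  saturated V -> has_descent V.
Proof.
move=> Vsat m n a v v_desc.
pose val q (c : mor m q) : V q :=
  if [pick b | c == mor_comp b a] is Some b then cm_act V b v else 0.
have valE q (b : mor n q) : val q (mor_comp b a) = cm_act V b v.
  rewrite /val; case: pickP => [c /eqP/esym/v_desc//|/(_ b)].
  by rewrite eqxx.
(* u is zero unless a has a left inverse, hence is an identity; it is
   subtracted so that w is normalized in all cases. *)
pose u := val m (mor_id m).
pose w : cochain V m := fun q c => val q c - cm_act V c u.
have w0 : w \in normalized V m by rewrite inE /w cm_act1 subrr.
have wa : w n a = v - cm_act V a u.
  by rewrite /w -{1}[a]mor_comp1m valE cm_act1.
have aw : cm_act (nc_cmodule V) a (NCochain w0) = 0.
  apply/val_inj/cochainP => q c.
  rewrite -[LHS]/(w q (mor_comp c a) - cm_act V c (w n a)) wa /w valE.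
  by rewrite linearB cm_actM subrr.
have Tw : (NCochain w0 : nc_cmodule V m) \in
    sub_mem (torsion_part (nc_cmodule V)) m.
  by apply/torsion_partP; exists n, a.
have [_ ext0] := Vsat _ (@torsion_part_torsion k (nc_cmodule V)).
have [phi [phi_in _]] := ext0 (tw_extension _).
pose z : tw_cmodule (torsion_part (nc_cmodule V)) m := (0, SubCarrier Tw).
exists ((phi m z).1 + u).
have az : cm_act (tw_cmodule _) a z = tw_in _ n (v - cm_act V a u).
  apply/pair_equal_spec; split; first by rewrite linear0 add0r -wa.
  exact: val_inj.
have := hom_nat phi a z; rewrite az phi_in => /(congr1 fst) /= E.
by rewrite linearD -E subrK.
Qed.

Lemma saturatedP (k : fieldType) (V : cmodule k) : saturated V <-> sheaf V.
Proof.
split=> [Vsat|]; last exact: sheaf_saturated.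
by split; [exact: saturated_torsion_free|exact: saturated_has_descent].
Qed.

(** * Passing to submodules and relations *)

Lemma sub_torsion_free (k : fieldType) (V : cmodule k) (S : submodule V) :
  torsion_free V -> torsion_free (sub_cmodule S).
Proof.
move=> Vtf m n a x /(congr1 (sub_incl S n)).
by rewrite linear0 hom_nat => /Vtf x0; apply/val_inj.
Qed.

Lemma sub_sheaf (k : fieldType) (V : cmodule k) (S : submodule V) :
  sat_closed S -> sheaf V -> sheaf (sub_cmodule S).
Proof.
move=> Scl [Vtf Vd]; split; first exact: sub_torsion_free.
move=> m n a v v_desc; have [p b c bc|u uv] := Vd _ _ a (sub_val v).
  by have /(congr1 (sub_incl S p)) := v_desc p b c bc.
have Su : u \in sub_mem S m by apply: (Scl _ _ a); rewrite uv sub_valP.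
by exists (SubCarrier Su); apply/val_inj.
Qed.

Lemma ker_sat_closed (k : fieldType) (V W : cmodule k) (f : cm_hom V W) :
  torsion_free W -> sat_closed (ker_submodule f).
Proof.
by move=> Wtf m n a x /eqP; rewrite hom_nat => /Wtf fx; apply/eqP.
Qed.

Lemma hom_image_sat_closed (k : fieldType) (V W : cmodule k) (f : cm_hom V W) :
  has_descent V -> torsion_free W -> (forall n, injective (f n)) ->
  sat_closed (hom_image f).
Proof.
move=> Vd Wtf f_inj m n a y /in_hom_image[x fx]; apply/in_hom_image.
have [p b c bc|u ux] := Vd _ _ a x.
  by apply: f_inj; rewrite !hom_nat fx -!cm_actM bc.
by exists u; apply: (torsion_free_inj Wtf (a := a)); rewrite -hom_nat ux.
Qed.

Lemma functional_saturation (k : fieldType) (V W : cmodule k)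
    (R : submodule (dsum V W)) :
  torsion_free W -> functional R -> functional (saturation R).
Proof.
move=> Wtf Rf n y /in_saturationP[m [a]].
rewrite -[cm_act _ _ _]/(cm_act V a 0, cm_act W a y) linear0.
by move=> /Rf/Wtf.
Qed.

Definition graph_domain (k : fieldType) (V W : cmodule k)
    (R : submodule (dsum V W)) :
  submodule V.
Proof.
apply: (@submodule_of k V
  (fun n x => exists y, ((x, y) : dsum V W n) \in sub_mem R n)).
- by move=> n; exists 0; apply: rpred0.
- move=> n c x x' [y Ry] [y' Ry']; exists (c *: y + y').
  exact: rpredD (rpredZ c Ry) Ry'.
- by move=> m n a x [y Ry]; exists (cm_act W a y); apply: (sub_act a Ry).
Defined.

Lemma in_graph_domain (k : fieldType) (V W : cmodule k)
    (R : submodule (dsum V W)) n (x : V n) :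
  x \in sub_mem (graph_domain R) n <->
  exists y, ((x, y) : dsum V W n) \in sub_mem R n.
Proof. exact: in_submodule_of. Qed.

Lemma graph_domain_sat_closed (k : fieldType) (V W : cmodule k)
    (R : submodule (dsum V W)) :
  has_descent W -> functional R -> sat_closed R -> sat_closed (graph_domain R).
Proof.
move=> Wd Rf Rcl m n a x /in_graph_domain[y Ry]; apply/in_graph_domain.
have [p b c bc|u uy] := Wd _ _ a y.
  apply: (functional_eq Rf (x := cm_act V b (cm_act V a x))).
    exact: (sub_act b Ry).
  by rewrite -cm_actM bc cm_actM; exact: (sub_act c Ry).
by exists u; apply: (Rcl _ _ a); rewrite -uy in Ry.
Qed.

Definition graph_null (k : fieldType) (V W : cmodule k)
    (R : submodule (dsum V W)) : submodule V.
Proof.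
apply: (@submodule_of k V
  (fun n x => ((x, 0) : dsum V W n) \in sub_mem R n)).
- by move=> n; apply: rpred0.
- move=> n c x y Rx Ry; have := rpredD (rpredZ c Rx) Ry.
  by rewrite -[_ + _]/((c *: x + y, c *: 0 + 0) : dsum V W n) scaler0 addr0.
- move=> m n a x /(sub_act a).
  by rewrite -[cm_act _ _ _]/(cm_act V a x, cm_act W a 0) linear0.
Defined.

Lemma in_graph_null (k : fieldType) (V W : cmodule k) (R : submodule (dsum V W))
    n (x : V n) : x \in sub_mem (graph_null R) n <->
  ((x, 0) : dsum V W n) \in sub_mem R n.
Proof. exact: in_submodule_of. Qed.

Lemma graph_null_sat_closed (k : fieldType) (V W : cmodule k)
    (R : submodule (dsum V W)) : sat_closed R -> sat_closed (graph_null R).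
Proof.
move=> Rcl m n a x /in_graph_null Rax; apply/in_graph_null/(Rcl _ _ a).
by rewrite -[cm_act _ _ _]/(cm_act V a x, cm_act W a 0) linear0.
Qed.

(** * Free modules *)

Lemma free_act_comp (k : fieldType) n m l (a : mor m l)
    (x : free_cmodule k n m) (b : mor n m) :
  (cm_act (free_cmodule k n) a x : {ffun _}) (mor_comp a b) =
  (x : {ffun _}) b.
Proof.
rewrite -[cm_act _ _ _]/(lin_ext _ x) /lin_ext sum_ffunE (bigD1 b) //=.
rewrite big1 => [|c cb].
  by rewrite !ffunE eqxx addr0 /GRing.scale/= mulr1.
rewrite !ffunE; case: eqP => [acb|_]; last exact: scaler0.
case/eqP: cb; apply: mor_eqP => i; apply: (@mor_inj _ _ a).
by rewrite -!mor_compE acb.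
Qed.

Lemma free_act_out (k : fieldType) n m l (a : mor m l)
    (x : free_cmodule k n m) (c : mor n l) :
  (forall b, c <> mor_comp a b) ->
  (cm_act (free_cmodule k n) a x : {ffun _}) c = 0.
Proof.
move=> c_out; rewrite -[cm_act _ _ _]/(lin_ext _ x) /lin_ext sum_ffunE.
rewrite big1 // => b _; rewrite !ffunE; case: eqP => [/c_out//|_].
exact: scaler0.
Qed.

Lemma free_torsion_free (k : fieldType) n : torsion_free (free_cmodule k n).
Proof.
move=> m l a x ax; apply/ffunP=> b.
by rewrite -(free_act_comp a x b) ax !ffunE.
Qed.

(** If an n-element subset b in the support of v had a point x outside the image
    of a, two morphisms [q] -> [q+1] that differ only in sending x to x + 1 and
    to x would agree along a but not on v, since only the first one puts x + 1
    into subsets coming from b. *)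
Lemma free_has_descent (k : fieldType) n : has_descent (free_cmodule k n).
Proof.
move=> m q a v v_desc.
have v_supp (b : mor n q) i : b i \notin codom a -> (v : {ffun _}) b = 0.
  set x := b i => xa.
  pose c := skip (widen_ord (leqnSn q) x); pose d := skip (lift ord0 x).
  have cx : c (b i) = x.+1 :> nat by rewrite /c/= ffunE /= /bump leqnn.
  have cd : mor_comp c a = mor_comp d a.
    apply: mor_nat_eqP => j; rewrite !mor_compE /= !ffunE /= /bump /=.
    have : a j <> x :> nat by move/val_inj => e; rewrite -e codom_f in xa.
    by move: (nat_of_ord _) (nat_of_ord _) => s t; lia.
  rewrite -(free_act_comp c v b) (v_desc _ c d cd) free_act_out // => e ce.
  have := congr1 (fun f : mor n q.+1 => nat_of_ord (f i)) ce.
  rewrite !mor_compE cx => /esym; rewrite /d/= ffunE /= /bump /=.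
  by move: (nat_of_ord _) (nat_of_ord _) => s t; lia.
exists [ffun b => (v : {ffun _}) (mor_comp a b)]; apply/ffunP=> c.
have [/forallP ca|] := boolP [forall i, c i \in codom a].
  have [b ->] := mor_factor ca.
  by rewrite free_act_comp ffunE.
rewrite negb_forall => /existsP[i ci].
rewrite (v_supp _ _ ci) free_act_out // => b cb.
by rewrite cb mor_compE codom_f in ci.
Qed.

Lemma free_sheaf (k : fieldType) n : sheaf (free_cmodule k n).
Proof. by split; [exact: free_torsion_free|exact: free_has_descent]. Qed.

(** The map f_i followed by the inclusion of its codomain into M(m). *)
Definition face (k : fieldType) m (i : 'I_m.+1) :
    cm_hom (free_cmodule k m.+1) (free_cmodule k m) :=
  free_hom (skip_elt k i).

Lemma in_K (k : fieldType) m (i : 'I_m.+1) l (x : free_cmodule k m.+1 l) :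
  x \in sub_mem (K k i) l <-> face k i l x = 0.
Proof.
have <- : sub_incl _ l (f_hom k i l x) = face k i l x.
  by rewrite [f_hom k i l x]/(lin_ext _ x) linear_sum; apply: eq_bigr => b _;
    rewrite linearZ.
by split=> [/eqP->|fx]; [rewrite linear0|apply/eqP/val_inj].
Qed.

Lemma in_cap_K (k : fieldType) m l (x : free_cmodule k m.+1 l) :
  x \in sub_mem (cap_K k m.+1) l <-> forall i, face k i l x = 0.
Proof.
split=> [/forallP Kx i|Kx]; first exact/in_K.
by apply/forallP=> i; apply/in_K.
Qed.

Lemma cap_K_sat_closed (k : fieldType) n : sat_closed (cap_K k n).
Proof.
case: n => [|n] m l a x //; move=> /in_cap_K Kax; apply/in_cap_K => i.
by apply: (@free_torsion_free k n _ _ a); rewrite -hom_nat.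
Qed.

Lemma cap_K_sheaf (k : fieldType) n : sheaf (sub_cmodule (cap_K k n)).
Proof. exact: sub_sheaf (@cap_K_sat_closed k n) (free_sheaf k n). Qed.

(** * The alternating element *)

Fact spread_lt m (e : 'I_m -> bool) (x : 'I_m) : (x.*2 + e x < m.*2)%N.
Proof. by have := ltn_ord x; case: (e x); lia. Qed.
Fact spread_incr m (e : 'I_m -> bool) :
  {homo (fun x => Ordinal (spread_lt e x)) : i j / (i < j)%N}.
Proof. by move=> i j ij /=; case: (e i); case: (e j); lia. Qed.
(** Each point x is replaced by two consecutive points 2x and 2x + 1, and e
    chooses one of them; every choice is increasing. *)
Definition spread m (e : 'I_m -> bool) : mor m m.*2 :=
  Mor (increasing_fun (@spread_incr m e)).
Lemma spreadE m (e : 'I_m -> bool) x : spread e x = (x.*2 + e x)%N :> nat.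
Proof. by rewrite /= ffunE. Qed.

Definition parity_sign (k : fieldType) n (e : {ffun 'I_n -> bool}) : k :=
  \prod_i (-1) ^+ e i.

Definition flip n (i : 'I_n) (e : {ffun 'I_n -> bool}) : {ffun 'I_n -> bool} :=
  [ffun j => e j (+) (j == i)].

Lemma flipK n (i : 'I_n) : involutive (flip i).
Proof. by move=> e; apply/ffunP=> j; rewrite !ffunE addbK. Qed.

Lemma parity_sign_flip (k : fieldType) n (i : 'I_n) e :
  parity_sign k (flip i e) = - parity_sign k e.
Proof.
rewrite /parity_sign (bigD1 i) //= [in RHS](bigD1 i) //= ffunE eqxx addbT.
rewrite signrN mulNr; congr (- (_ * _)); apply: eq_bigr => j ji.
by rewrite ffunE (negPf ji) addbF.
Qed.

(** The terms are paired by flipping the i-th sign.  Splitting the sum according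
    to the value of e at i, rather than showing that it equals its opposite,
    makes the argument valid in characteristic two. *)
Lemma alt_sum_eq0 (k : fieldType) n (W : lmodType k) (i : 'I_n)
    (F : {ffun 'I_n -> bool} -> W) :
  (forall e, F (flip i e) = F e) -> \sum_e parity_sign k e *: F e = 0.
Proof.
move=> F_indep; rewrite (bigID (fun e : {ffun _} => e i)) /=.
rewrite [X in _ + X](reindex_inj (inv_inj (flipK i))) /=.
rewrite [X in _ + X](eq_bigl (fun e : {ffun _} => e i)); last first.
  by move=> e; rewrite ffunE eqxx addbT negbK.
rewrite -big_split big1 // => e _.
by rewrite parity_sign_flip F_indep /= scaleNr subrr.
Qed.

Definition alt (k : fieldType) n : free_cmodule k n n.*2 :=
  \sum_(e : {ffun 'I_n -> bool}) parity_sign k e *: delta k (spread e).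

Lemma hom_alt (k : fieldType) n (V : cmodule k) (v : V n) :
  free_hom v n.*2 (alt k n) =
  \sum_(e : {ffun 'I_n -> bool}) parity_sign k e *: cm_act V (spread e) v.
Proof.
by rewrite linear_sum; apply: eq_bigr => e _; rewrite linearZ /= lin_ext_delta.
Qed.

Lemma act_alt (k : fieldType) n m (a : mor n.*2 m) :
  cm_act (free_cmodule k n) a (alt k n) =
  \sum_(e : {ffun 'I_n -> bool})
    parity_sign k e *: delta k (mor_comp a (spread e)).
Proof.
by rewrite linear_sum; apply: eq_bigr => e _; rewrite linearZ /= lin_ext_delta.
Qed.

Lemma alt_neq0 (k : fieldType) n : alt k n != 0.
Proof.
apply/eqP=> /ffunP/(_ (spread [ffun=> false])).
rewrite sum_ffunE (bigD1 [ffun=> false]) //= big1 => [|e e0]; last first.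
  rewrite !ffunE; case: eqP => [E|_]; last exact: scaler0.
  case/eqP: e0; apply/ffunP=> i.
  have := congr1 (fun b : mor n n.*2 => nat_of_ord (b i)) E.
  by rewrite !spreadE !ffunE; case: (e i); lia.
rewrite !ffunE eqxx addr0 /parity_sign big1 => [|i _]; last by rewrite ffunE.
by rewrite scale1r => /eqP; rewrite oner_eq0.
Qed.

(** Forgetting the i-th point makes the terms independent of the i-th sign. *)
Lemma alt_in_cap_K (k : fieldType) n : alt k n \in sub_mem (cap_K k n) n.*2.
Proof.
case: n => [//|n]; apply/in_cap_K => i; rewrite hom_alt.
apply: (alt_sum_eq0 (i := i)) => e /=; rewrite !lin_ext_delta.
congr (delta k _).
apply: mor_nat_eqP => j; rewrite !mor_compE !spreadE ffunE.
by rewrite /= ffunE eq_sym (negPf (neq_lift _ _)) addbF.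
Qed.

Fact half_lt n (y : 'I_n.*2) : (y./2 < n)%N.
Proof. by have := ltn_ord y; lia. Qed.
Fact double_lt n m (b : mor n m) (y : 'I_n.*2) :
  ((b (Ordinal (half_lt y))).*2 + odd y < m.*2)%N.
Proof. by have := ltn_ord (b (Ordinal (half_lt y))); case: (odd y); lia. Qed.
Fact double_incr n m (b : mor n m) :
  {homo (fun y => Ordinal (double_lt b y)) : i j / (i < j)%N}.
Proof.
move=> i j ij /=.
case: (ltngtP (i./2) (j./2)) => [hij|hji|hij]; last 2 first.
- by lia.
- have -> : Ordinal (half_lt i) = Ordinal (half_lt j) by apply/val_inj.
  by move: (nat_of_ord (b _)) => t; lia.
have := @mor_lt _ _ b (Ordinal (half_lt i)) (Ordinal (half_lt j)) hij.
by case: (odd i); case: (odd j); lia.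
Qed.
(** Acts on both copies of each point at once. *)
Definition double_mor n m (b : mor n m) : mor n.*2 m.*2 :=
  Mor (increasing_fun (@double_incr n m b)).

Lemma double_spread n m (b : mor n m) (e : 'I_n -> bool) i :
  double_mor b (spread e i) = ((b i).*2 + e i)%N :> nat.
Proof.
rewrite /= ffunE /=; congr ((nat_of_ord (b _)).*2 + _)%N.
  by apply/val_inj; rewrite /= ffunE /=; case: (e i); lia.
by rewrite ffunE /=; case: (e i); lia.
Qed.

(** If v has a nonzero coefficient at b, the alternating sum over the choices of
    copies of the points of b annihilates every other basis element, since it
    misses a point of b, and leaves a nonzero multiple of the translate of the
    alternating element along b. *)
Lemma alt_in_sat_closed (k : fieldType) n (S : submodule (free_cmodule k n))
    m (v : free_cmodule k n m) :
  sat_closed S -> v \in sub_mem S m -> v != 0 -> alt k n \in sub_mem S n.*2.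
Proof.
move=> Scl Sv v0.
have [b vb] : exists b, (v : {ffun _}) b != 0.
  apply/existsP; apply: contraR v0; rewrite negb_exists => /forallP v0.
  by apply/eqP/ffunP=> b; have := v0 b; rewrite negbK => /eqP->; rewrite ffunE.
(* The choice of copies e, transported to the points of b; points outside b
   always keep their lower copy. *)
pose push (e : {ffun 'I_n -> bool}) x := [exists i, (b i == x) && e i].
have pushE e i : push e (b i) = e i.
  apply/existsP/idP => [[j /andP[/eqP/mor_inj->]]//|ei].
  by exists i; rewrite eqxx.
suff E : \sum_e parity_sign k e *:
      cm_act (free_cmodule k n) (spread (push e)) v =
    (v : {ffun _}) b *: cm_act (free_cmodule k n) (double_mor b) (alt k n).
  apply: (Scl _ _ (double_mor b)); rewrite -[X in X \in _](scalerK vb) -E.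
  by apply/rpredZ/rpred_sum => e _; apply/rpredZ/sub_act.
rewrite act_alt.
under eq_bigr => e _ do rewrite -[cm_act _ _ _]/(lin_ext _ v) scaler_sumr.
rewrite exchange_big /= (bigD1 b) //= [X in _ + X]big1 => [|c cb]; last first.
  have [i bi] := mor_missing cb.
  under eq_bigr => e _ do rewrite scalerA mulrC -scalerA.
  rewrite -scaler_sumr (alt_sum_eq0 (i := i)) ?scaler0 // => e.
  congr (delta k _); apply: mor_nat_eqP => j; rewrite !mor_compE !spreadE.
  congr (_ + nat_of_bool _)%N; apply: eq_existsb => h; rewrite ffunE.
  have [hi|_] := eqVneq h i; last by rewrite addbF.
  by case: eqP => // bh; rewrite -hi bh codom_f in bi.
rewrite addr0 scaler_sumr; apply: eq_bigr => e _.
rewrite scalerA mulrC -scalerA; congr (_ *: (_ *: delta k _)).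
apply: mor_nat_eqP => i; rewrite !mor_compE double_spread spreadE.
by rewrite pushE.
Qed.

(** * The alternating element generates the intersection of the kernels *)

(** The i-th kernel condition says that the coefficients of w add up to zero
    over each fibre of b |-> b o skip i, and F is constant on these fibres. *)
Lemma cap_K_sum (k : fieldType) n l (w : free_cmodule k n.+1 l)
    (W : lmodType k) (i : 'I_n.+1) (F : mor n.+1 l -> W) :
  w \in sub_mem (cap_K k n.+1) l ->
  (forall b c, mor_comp b (skip i) = mor_comp c (skip i) -> F b = F c) ->
  \sum_b ((w : {ffun _}) b : k) *: F b = 0.
Proof.
move=> /in_cap_K/(_ i) wi F_face.
rewrite (partition_big (fun b => mor_comp b (skip i)) predT) //= big1 // => c _.
have [b /eqP bc|none] := pickP (fun b => mor_comp b (skip i) == c); last first.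
  by rewrite big_pred0.
rewrite (eq_bigr (fun b' => ((w : {ffun _}) b' : k) *: F b)) => [|b' /eqP b'c].
  rewrite -scaler_suml; suff -> : \sum_(b' | mor_comp b' (skip i) == c)
      ((w : {ffun _}) b' : k) = 0 by rewrite scale0r.
  have /ffunP/(_ c) := wi; rewrite [RHS]ffunE; apply: etrans.
  rewrite -[face k i l w]/(lin_ext _ w) /lin_ext sum_ffunE big_mkcond /=.
  apply: eq_bigr => b' _; rewrite !lin_ext_delta !ffunE eq_sym.
  by case: eqP => _; rewrite /GRing.scale/= ?mulr1 ?mulr0.
by rewrite (F_face b' b) // b'c.
Qed.

(** The default l acts as an (n+1)-st point of b lying above [l], so that the
    last point of b also has a successor to be compared with. *)
Definition ext_value n l (b : mor n l) (j : nat) : nat :=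
  if insub j is Some i then b i else l.

Lemma ext_valueE n l (b : mor n l) (i : 'I_n) : ext_value b i = b i.
Proof. by rewrite /ext_value valK. Qed.

Lemma ext_value_incr n l (b : mor n l) i j :
  (i < j <= n)%N -> (ext_value b i < ext_value b j)%N.
Proof.
case/andP=> ij jn; have il : (i < n)%N := leq_trans ij jn.
rewrite -[i]/(nat_of_ord (Ordinal il)) ext_valueE.
rewrite /ext_value; case: insubP => [h _ hj|_]; last exact: ltn_ord.
by apply: mor_lt; rewrite hj.
Qed.

Lemma ext_value_le n l (b : mor n l) i : (ext_value b i <= l)%N.
Proof. by rewrite /ext_value; case: insubP => [h _ _|_] //; apply: ltnW. Qed.

(** The pair 2i, 2i + 1 goes to the upper copy of b_i and to the lower copy of
    b_(i+1): uphalf is i on the first and i + 1 on the second. *)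
Definition interlace_fun n l (b : mor n l) (y : nat) : nat :=
  (ext_value b (uphalf y)).*2 + ~~ odd y.

Fact interlace_incr n l (b : mor n l) x y :
  (x < y < n.*2)%N -> (interlace_fun b x < interlace_fun b y)%N.
Proof.
move=> xy; rewrite /interlace_fun.
case: (ltngtP (uphalf x) (uphalf y)) => [h|h|h]; last 2 first.
- by lia.
- by rewrite h; move: (ext_value _ _) => t; lia.
have /(ext_value_incr b) : (uphalf x < uphalf y <= n)%N by lia.
by move: (ext_value _ _) (ext_value _ _) => s t; lia.
Qed.
Fact interlace_lt n l (b : mor n l) y :
  (y < n.*2)%N -> (interlace_fun b y < l.*2.+1)%N.
Proof.
rewrite /interlace_fun; case: (boolP (odd y)) => /= y_odd yn.
  by have := ext_value_le b (uphalf y); lia.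
have /(ext_value_incr b) : (uphalf y < n <= n)%N by lia.
by have := ext_value_le b n; lia.
Qed.
Definition interlace n l (b : mor n l) : mor n.*2 l.*2.+1 :=
  nat_mor (@interlace_incr n l b) (@interlace_lt n l b).

Lemma interlace_spread n l (b : mor n l) (e : 'I_n -> bool) i :
  interlace b (spread e i) = ((ext_value b (i + e i)).*2 + ~~ e i)%N :> nat.
Proof.
rewrite nat_morE spreadE /interlace_fun; congr ((ext_value b _).*2 + _)%N.
  by case: (e i); lia.
by case: (e i); lia.
Qed.

Fact odd_emb_incr l x y : (x < y < l)%N -> (x.*2.+1 < y.*2.+1)%N.
Proof. by lia. Qed.
Fact odd_emb_lt l x : (x < l)%N -> (x.*2.+1 < l.*2.+1)%N.
Proof. by lia. Qed.
Definition odd_emb l : mor l l.*2.+1 :=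
  nat_mor (@odd_emb_incr l) (@odd_emb_lt l).

(** Only the i-th value of b is lost in b o skip i. *)
Lemma ext_value_off n l (b c : mor n.+1 l) (i : 'I_n.+1) j :
  mor_comp b (skip i) = mor_comp c (skip i) -> j != i :> nat ->
  ext_value b j = ext_value c j.
Proof.
move=> bc ji; rewrite /ext_value; case: insubP => // h _ hj.
have /unlift_some[h' -> _] : i != h by apply: contraNneq ji => ->; rewrite hj.
have := congr1 (fun f : mor n l => nat_of_ord (f h')) bc.
by rewrite !mor_compE /= !ffunE.
Qed.

(** In the expansion of the right-hand side over e, the term e = 0 uses only
    upper copies and gives the left-hand side. For e <> 0 let i be the first
    index with e i = 1: position i uses b_(i+1), and no earlier position is
    shifted, so that b_i does not occur; the term vanishes by [cap_K_sum]. *)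
Lemma alt_span_cap_K (k : fieldType) n l (w : free_cmodule k n l) :
  w \in sub_mem (cap_K k n) l ->
  cm_act (free_cmodule k n) (odd_emb l) w =
  \sum_b ((w : {ffun _}) b : k) *:
    cm_act (free_cmodule k n) (interlace b) (alt k n).
Proof.
move=> Kw; under [RHS]eq_bigr => b _ do rewrite act_alt scaler_sumr.
rewrite exchange_big /= (bigD1 [ffun=> false]) //= [X in _ + X]big1 ?addr0.
  apply: eq_bigr => b _.
  rewrite /parity_sign big1 => [|i _]; last by rewrite ffunE.
  rewrite scale1r; congr (_ *: delta k _); apply: mor_nat_eqP => i.
  by rewrite !mor_compE interlace_spread nat_morE ffunE addn0 ext_valueE addn1.
move=> e e0; under eq_bigr => b _ do rewrite scalerA mulrC -scalerA.
rewrite -scaler_sumr.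
have [i0 ei0] : exists i, e i.
  apply/existsP; apply: contraR e0; rewrite negb_exists => /forallP e0.
  by apply/eqP/ffunP=> i; rewrite ffunE; apply/negbTE.
case: n w Kw e i0 {e0} ei0 => [? ? ? [] //|n] w Kw e i0 ei0.
have [i ei i_min] := arg_minnP (fun i : 'I_n.+1 => nat_of_ord i) ei0.
rewrite (cap_K_sum (i := i) Kw) ?scaler0 // => b c bc.
congr (delta k _); apply: mor_nat_eqP => j.
rewrite !mor_compE !interlace_spread.
rewrite (ext_value_off bc) //.
have [ej|ej] := boolP (e j); first by have := i_min _ ej; lia.
by rewrite addn0; apply: contraNneq ej => /val_inj->.
Qed.

(** S contains the alternating element, which generates the intersection of the
    kernels up to torsion. *)
Lemma cap_K_minimal (k : fieldType) n (S : submodule (free_cmodule k n))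
    m (v : free_cmodule k n m) l (w : free_cmodule k n l) :
  sat_closed S -> v \in sub_mem S m -> v != 0 ->
  w \in sub_mem (cap_K k n) l -> w \in sub_mem S l.
Proof.
move=> Scl Sv v0 /alt_span_cap_K wE; apply: (Scl _ _ (odd_emb l)); rewrite wE.
apply: rpred_sum => b _; apply/rpredZ/sub_act.
exact: alt_in_sat_closed Sv v0.
Qed.

(** * Simplicity *)

(** The kernel is itself saturated, so that it may be used as a test object. *)
Lemma sat_mono_inj (k : fieldType) (U V : cmodule k) (f : cm_hom U V) n :
  sheaf U -> torsion_free V -> sat_mono f -> injective (f n).
Proof.
move=> Ush Vtf f_mono x y fxy; apply/eqP; rewrite -subr_eq0; apply/eqP.
have Kxy : x - y \in sub_mem (ker_submodule f) n.
  by apply/eqP; rewrite linearB fxy subrr.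
have Ksat : saturated (sub_cmodule (ker_submodule f)).
  by apply/saturatedP/sub_sheaf/Ush/ker_sat_closed.
pose z := @hom_of k (sub_cmodule (ker_submodule f)) U (fun n x => 0).
have z_lin m : linear (fun x : sub_cmodule (ker_submodule f) m => 0 : U m).
  by move=> c u v; rewrite scaler0 addr0.
have z_nat m l (a : mor m l) (u : sub_cmodule (ker_submodule f) m) :
  (0 : U l) = cm_act U a 0 by rewrite linear0.
apply: (f_mono _ Ksat (sub_incl _) (z z_lin z_nat) _ n (SubCarrier Kxy)).
by move=> m u; rewrite [RHS]linear0; apply/eqP/(sub_valP u).
Qed.

Lemma inj_sat_mono (k : fieldType) (U V : cmodule k) (f : cm_hom U V) :
  (forall n, injective (f n)) -> sat_mono f.
Proof. by move=> f_inj W _ g h fgh n x; apply/f_inj/fgh. Qed.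

Lemma cap_K_simple (k : fieldType) n :
  simple_saturated (sub_cmodule (cap_K k n)).
Proof.
split; first exact/saturatedP/cap_K_sheaf.
  move=> /(_ _ (SubCarrier (alt_in_cap_K k n)))/(congr1 val)/eqP.
  exact/negP/alt_neq0.
move=> U f /saturatedP Ush f_mono.
have f_inj m : injective (f m).
  exact: sat_mono_inj Ush (cap_K_sheaf k n).1 f_mono.
have [|U_neq0] := pselect (zero_cmodule U); first by left.
right; apply: bij_hom_iso => // l y.
pose g := comp_hom (sub_incl (cap_K k n)) f.
have g_inj m : injective (g m) by move=> u v /val_inj/f_inj.
have g_cl : sat_closed (hom_image g).
  exact: hom_image_sat_closed Ush.2 (@free_torsion_free k n) g_inj.
have [m [x x0]] : exists m (x : U m), x != 0.
  apply: contrapT => U0; apply: U_neq0 => m x; apply: contrapT => /eqP x0.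
  by apply: U0; exists m, x.
have Igx : g m x \in sub_mem (hom_image g) m by apply/in_hom_image; exists x.
have gx0 : g m x != 0.
  by apply: contraNneq x0 => gx; apply/eqP/(g_inj m); rewrite gx linear0.
have /in_hom_image[u gu] := cap_K_minimal g_cl Igx gx0 (sub_valP y).
by exists u; apply/val_inj.
Qed.

(** * Every simple saturated module occurs *)

Definition has_value (k : fieldType) (V : cmodule k) n
    (R : submodule (dsum (free_cmodule k n) V)) l
    (x : free_cmodule k n l) : Prop :=
  exists2 y : V l, ((x, y) : dsum _ V l) \in sub_mem R l & y != 0.

Lemma first_failure (P : nat -> Prop) n :
  P 0 -> ~ P n -> exists i, [/\ (i < n)%N, P i & ~ P i.+1].
Proof.
elim: n => // n IHn P0 Pn; have [Pn'|nPn] := pselect (P n).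
  by exists n.
by have [i [ilt Pi nPi]] := IHn P0 nPn; exists i; split=> //; apply: leqW.
Qed.

(** If R vanishes on the intersection of all kernels, there is a j such that it
    is nonzero on the intersection of the first j kernels but not on that of the
    first j + 1. So its restriction to the first j kernels stays functional when
    pushed forward along the next face map, which lowers n by one. *)
Lemma subquotient_cap_K (k : fieldType) (V : cmodule k) n
    (R : submodule (dsum (free_cmodule k n) V)) l (x : free_cmodule k n l) :
  functional R -> has_value R x ->
  exists n' (R' : submodule (dsum (free_cmodule k n') V)) l'
    (x' : free_cmodule k n' l'),
    [/\ functional R', has_value R' x' & x' \in sub_mem (cap_K k n') l'].
Proof.
elim: n R l x => [|n IHn] R l x Rf Rx; first by exists 0%N, R, l, x.
pose M := free_cmodule k n.+1; pose N := free_cmodule k n.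
pose P j := exists l (x : M l),
  has_value R x /\ forall i : 'I_n.+1, (i < j)%N -> face k i l x = 0.
have [[m [z [Rz Kz]]]|nP] := pselect (P n.+1).
  exists n.+1, R, m, z; split=> //; apply/in_cap_K => i; exact: Kz.
have [|j [jn [m [z [[y Rzy y0] Kz]]] nPj]] := first_failure _ nP.
  by exists l, x.
pose i := Ordinal jn.
(* The pushforward along the face i of R restricted to the first j kernels. *)
pose Q m (p : dsum N V m) := exists x : M m,
  [/\ ((x, p.2) : dsum M V m) \in sub_mem R m,
      forall h : 'I_n.+1, (h < j)%N -> face k h m x = 0 &
      face k i m x = p.1].
have Q0 p : Q p 0.
  exists 0; split=> [|h _|]; [exact: rpred0|exact: linear0|exact: linear0].
have Q_lin p c u v : Q p u -> Q p v -> Q p (c *: u + v).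
  case=> [s [Rs Ks fs]] [t [Rt Kt ft]]; exists (c *: s + t).
  split=> [|h hj|]; first exact: rpredD (rpredZ c Rs) Rt.
    by rewrite linearP Kt // Ks // scaler0 addr0.
  by rewrite linearP fs ft.
have Q_act p q (a : mor p q) u : Q p u -> Q q (cm_act _ a u).
  case=> [s [Rs Ks fs]]; exists (cm_act M a s).
  split=> [|h hj|]; first exact: (sub_act a Rs).
    by rewrite hom_nat Ks // linear0.
  by rewrite hom_nat fs.
apply: (IHn (submodule_of Q0 Q_lin Q_act) m (face k i m z)).
  move=> p v /in_submodule_of[s [/= Rs Ks fs]].
  apply: contrapT => /eqP v0; apply: nPj; exists p, s; split; first by exists v.
  move=> h; rewrite ltnS leq_eqVlt => /predU1P[hj|]; last exact: Ks.
  by rewrite (_ : h = i) //; apply/val_inj.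
by exists y => //; apply/in_submodule_of; exists z.
Qed.

(** The saturated relation R obtained from [subquotient_cap_K] is nonzero on
    some intersection C of kernels. Its domain, and the elements related to
    zero, are saturated submodules of M(n), so each contains C or is zero: the
    domain contains C, and nothing nonzero in C is related to zero, since
    otherwise all of C would be. *)
Lemma simple_saturated_cap_K (k : fieldType) (V : cmodule k) :
  simple_saturated V -> exists n, isomorphic V (sub_cmodule (cap_K k n)).
Proof.
case=> /saturatedP[Vtf Vd] V_neq0 V_simple.
have [m [v v0]] : exists m (v : V m), v != 0.
  apply: contrapT => V0; apply: V_neq0 => m x; apply: contrapT => /eqP x0.
  by apply: V0; exists m, x.
have [n [R0 [l [x [R0f [y R0xy y0] Kx]]]]] :
  exists n (R : submodule (dsum (free_cmodule k n) V)) l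
    (x : free_cmodule k n l),
    [/\ functional R, has_value R x & x \in sub_mem (cap_K k n) l].
  pose G l (p : dsum (free_cmodule k m) V l) := free_hom v l p.1 = p.2.
  have G0 p : G p 0 by exact: linear0.
  have G_lin p c s t : G p s -> G p t -> G p (c *: s + t).
    move=> Gs Gt; rewrite /G -[RHS]/(c *: s.2 + t.2) -Gs -Gt.
    exact: linearP.
  have G_act p q (a : mor p q) s : G p s -> G q (cm_act _ a s).
    by move=> Gs; rewrite /G -[RHS]/(cm_act V a s.2) -Gs; exact: hom_nat.
  apply: (@subquotient_cap_K k V m (submodule_of G0 G_lin G_act) m
           (free_gen k m)).
    by move=> p w /in_submodule_of Gw; rewrite -[w]Gw; exact: linear0.
  by exists v => //; apply/in_submodule_of; exact: free_hom_gen.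
pose R := saturation R0; have Rf := functional_saturation Vtf R0f.
have Rcl := @saturation_closed _ _ R0.
have Rxy : ((x, y) : dsum (free_cmodule k n) V l) \in sub_mem R l.
  exact: sub_saturation.
have x0 : x != 0.
  by apply: contraNneq y0 => x0; apply/eqP/(Rf l); rewrite -x0.
have R_total p (w : free_cmodule k n p) : w \in sub_mem (cap_K k n) p ->
    exists u, ((w, u) : dsum (free_cmodule k n) V p) \in sub_mem R p.
  move=> Kw; apply/in_graph_domain.
  apply: (cap_K_minimal (graph_domain_sat_closed Vd Rf Rcl) _ x0 Kw).
  by apply/in_graph_domain; exists y.
have R_inj p (w : free_cmodule k n p) : w \in sub_mem (cap_K k n) p ->
    ((w, 0) : dsum (free_cmodule k n) V p) \in sub_mem R p -> w = 0.
  move=> Kw /in_graph_null Nw; apply: contrapT => /eqP w0.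
  have /in_graph_null := cap_K_minimal (graph_null_sat_closed Rcl) Nw w0 Kx.
  by move=> /(functional_eq Rf Rxy)/eqP; rewrite (negPf y0).
pose C := sub_cmodule (cap_K k n).
pose G p (z : dsum C V p) :=
  ((sub_val z.1, z.2) : dsum (free_cmodule k n) V p) \in sub_mem R p.
have G0 p : G p 0 by exact: rpred0.
have G_lin p c s t : G p s -> G p t -> G p (c *: s + t).
  by move=> Gs Gt; exact: rpredD (rpredZ c Gs) Gt.
have G_act p q (a : mor p q) s : G p s -> G q (cm_act _ a s).
  exact: (sub_act a).
have [p w|p w|h hG] := @hom_of_graph k C V (submodule_of G0 G_lin G_act).
- by move=> /in_submodule_of/Rf.
- by have [u Ru] := R_total p _ (sub_valP w); exists u; apply/in_submodule_of.
have h_inj p : injective (h p).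
  move=> s t /eqP; rewrite -subr_eq0 -linearB => /eqP hst.
  apply/eqP; rewrite -subr_eq0; apply/eqP/val_inj.
  apply: (R_inj p); first exact: sub_valP.
  by have /in_submodule_of := hG p (s - t); rewrite hst.
exists n; have [C_sat C_neq0 _] := cap_K_simple k n.
by have [/C_neq0|/cm_iso_sym] := V_simple C h C_sat (inj_sat_mono h_inj).
Qed.

Theorem theorem4p9 (k : fieldType) :
  (forall n : nat, simple_saturated (sub_cmodule (cap_K k n))) /\
  (forall V : cmodule k, simple_saturated V ->
     exists n : nat, isomorphic V (sub_cmodule (cap_K k n))).
Proof.
by split; [exact: cap_K_simple|exact: simple_saturated_cap_K].
Qed.
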